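(* Let $m,n$ be positive integers and let $T_n$ be a tree with $n$ vertices such that $\Delta(T_n)\leq n-3$ and $T_n$ is not isomorphic to $T(p,n-3-p)$ for any integer $p\geq1$. If $m+n-3$ is not a linear combination of $n-1$ and $n-2$, then $R(T_n,K_{1,m})\leq m+n-3$.
   Context: $K_{1,m}$ is the star with $m+1$ vertices. For graphs $G,H$, the Ramsey number $R(G,H)$ is the smallest integer $N$ such that every red-blue colouring of the edges of $K_N$ contains a red copy of $G$ or a blue copy of $H$. A non-negative integer $N$ is a linear combination of positive integers $p_1,\dots,p_r$ if $N=\sum_i k_ip_i$ for some non-negative integers $k_i$. For positive integers $p,q$, $T(p,q)$ denotes the tree consisting of a vertex $v_3$ adjacent to exactly two vertices $v_2,v_4$, where $v_2$ has $p$ further neighbours that are leaves and $v_4$ has $q$ further neighbours that are leaves (equivalently, a tree with a longest path $v_1v_2v_3v_4v_5$, $d(v_3)=2$, $v_2$ and $v_4$ having $p$ and $q$ leaves respectively). *)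

(* Defs.v *)
From mathcomp Require Import all_boot.

Set Implicit Arguments.
Unset Strict Implicit.
Unset Printing Implicit Defensive.

Record sgraph := SGraph {
  vertex :> finType;
  adj : rel vertex;
  adj_sym : symmetric adj;
  adj_irr : irreflexive adj }.

Arguments adj {s}.

Definition degree (G : sgraph) (x : G) : nat := #|[set y | adj x y]|.

Definition max_degree (G : sgraph) : nat := \max_(x : G) degree x.

Definition connected (G : sgraph) : Prop :=
  0 < #|G| /\ forall x y : G, connect adj x y.

(* [ucycle adj s]: s lists, without repetition, the vertices of a closed walk.
   The size condition excludes a single edge traversed back and forth. *)
Definition acyclic (G : sgraph) : Prop :=
  forall s : seq G, 2 < size s -> ~ ucycle adj s.

Definition is_tree (G : sgraph) : Prop := connected G /\ acyclic G.

Definition isomorphic (G H : sgraph) : Prop :=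
  exists f : G -> H, bijective f /\ forall x y, adj (f x) (f y) = adj x y.

(* The star K_{1,m}, with centre [None]. *)
Definition star_adj m : rel (option 'I_m) :=
  fun x y => (x == None) (+) (y == None).

Lemma star_adj_sym m : symmetric (@star_adj m).
Proof. by move=> x y; rewrite /star_adj addbC. Qed.

Lemma star_adj_irr m : irreflexive (@star_adj m).
Proof. by move=> x; rewrite /star_adj addbb. Qed.

Definition star m : sgraph := SGraph (@star_adj_sym m) (@star_adj_irr m).

(* T(p,q): the elements 0, 1, 2 of 'I_3 are v_2, v_3, v_4; the p leaves of the
   middle summand hang from v_2 and the q leaves of the last one from v_4. *)
Definition Tpq_arc p q (x y : 'I_3 + ('I_p + 'I_q)) : bool :=
  match x, y with
  | inl i, inl j => j == i.+1 :> nat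
  | inl i, inr (inl _) => i == 0 :> nat
  | inl i, inr (inr _) => i == 2 :> nat
  | _, _ => false
  end.

Definition Tpq_adj p q : rel ('I_3 + ('I_p + 'I_q)) :=
  fun x y => Tpq_arc x y || Tpq_arc y x.

Lemma Tpq_adj_sym p q : symmetric (@Tpq_adj p q).
Proof. by move=> x y; rewrite /Tpq_adj orbC. Qed.

Lemma Tpq_adj_irr p q : irreflexive (@Tpq_adj p q).
Proof. by rewrite /Tpq_adj; case=> [i|[i|i]] //=; rewrite orbb ltn_eqF. Qed.

Definition Tpq p q : sgraph := SGraph (@Tpq_adj_sym p q) (@Tpq_adj_irr p q).

(* A red-blue colouring of the edges of K_N: [true] is red, [false] is blue.
   Only the values at two-element sets, the edges of K_N, are ever used. *)
Definition colouring N := {ffun {set 'I_N} -> bool}.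

Definition mono_copy N (c : colouring N) (b : bool) (G : sgraph) : bool :=
  [exists f : {ffun G -> 'I_N}, injectiveb f &&
    [forall x, forall y, adj x y ==> (c [set f x; f y] == b)]].

Definition arrows N (G H : sgraph) : bool :=
  [forall c : colouring N, mono_copy c true G || mono_copy c false H].

Lemma ramsey_clique a b : exists N, forall (T : finType) (c : {set T} -> bool)
    (A : {set T}), N <= #|A| ->
  exists (d : bool) (S : {set T}), [/\ S \subset A,
    #|S| = (if d then a else b) &
    {in S &, forall x y, x != y -> c [set x; y] = d}].
Proof.
have [k le_k] := ubnP (a + b).
elim: k a b le_k => // k IHk [|a] [|b] le_k.
- exists 0 => T c A _; exists true, set0.
  by rewrite cards0 sub0set; split=> // x y; rewrite inE.
- exists 0 => T c A _; exists true, set0.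
  by rewrite cards0 sub0set; split=> // x y; rewrite inE.
- exists 0 => T c A _; exists false, set0.
  by rewrite cards0 sub0set; split=> // x y; rewrite inE.
have [|N1 ramN1] := IHk a b.+1; first by rewrite -ltnS.
have [|N2 ramN2] := IHk a.+1 b; first by rewrite -ltnS -addnS.
exists (N1 + N2).+1 => T c A leA.
have /card_gt0P[v vA] : 0 < #|A| by apply: leq_trans leA.
pose B d := [set x in A | (x != v) && (c [set v; x] == d)].
have cardB : #|B true| + #|B false| = #|A|.-1.
  rewrite (cardsD1 v A) vA /= -cardsUI.
  have -> : B true :&: B false = set0.
    by apply/setP=> x; rewrite !inE; case: (c _); rewrite ?andbF.
  rewrite cards0 addn0; apply: eq_card => x; rewrite !inE.
  by case: (x \in A) (c _) => [] []; rewrite ?andbF ?andbT ?orbF ?orbT.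
have sBA d : B d \subset A by apply/subsetP => x; rewrite inE => /andP[].
have extend d (S : {set T}) : S \subset B d ->
    {in S &, forall x y, x != y -> c [set x; y] = d} ->
  [/\ v |: S \subset A, #|v |: S| = #|S|.+1 &
    {in v |: S &, forall x y, x != y -> c [set x; y] = d}].
  move=> sB cS; have /subsetP sSB := sB.
  have vS : v \notin S by apply/negP => /sSB; rewrite !inE eqxx andbF.
  split=> [||x y]; first by rewrite subUset sub1set vA (subset_trans sB).
    by rewrite cardsU1 vS.
  rewrite !inE => /predU1P[-> | xS] /predU1P[-> | yS]; rewrite ?eqxx //.
  - by move=> _; have := sSB _ yS; rewrite !inE => /and3P[_ _ /eqP].
  - by move=> _; have := sSB _ xS; rewrite setUC !inE => /and3P[_ _ /eqP].
  - exact: cS.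
have [le1 | lt1] := leqP N1 #|B true|.
  have [[] [S [sSB cardS cS]]] := ramN1 T c _ le1.
    have [svS cardvS cvS] := extend _ _ sSB cS.
    by exists true, (v |: S); rewrite cardvS cardS.
  by exists false, S; rewrite (subset_trans sSB).
have le2 : N2 <= #|B false|.
  rewrite -(leq_add2l N1) -ltnS; apply: leq_trans leA _.
  rewrite (leq_trans (leqSpred _)) // -cardB ltnS leq_add2r.
  exact: ltnW.
have [[] [S [sSB cardS cS]]] := ramN2 T c _ le2.
  by exists true, S; rewrite (subset_trans sSB).
have [svS cardvS cvS] := extend _ _ sSB cS.
by exists false, (v |: S); rewrite cardvS cardS.
Qed.

Lemma ramsey_exists (G H : sgraph) : exists N, arrows N G H.
Proof.
have [N ramN] := ramsey_clique #|G| #|H|.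
exists N; apply/forallP => c.
have [|d [S [_ cardS cS]]] := ramN _ c [set: 'I_N].
  by rewrite cardsT card_ord.
have copy (K : sgraph) : #|S| = #|K| -> mono_copy c d K.
  move=> cardSK; apply/existsP.
  exists [ffun x => enum_val (cast_ord (esym cardSK) (enum_rank x))].
  have inj_f : injective (fun x : K =>
      enum_val (cast_ord (esym cardSK) (enum_rank x))).
    by move=> x y /enum_val_inj /cast_ord_inj /enum_rank_inj.
  apply/andP; split.
    by apply/injectiveP => x y; rewrite !ffunE; exact: inj_f.
  apply/forallP => x; apply/forallP => y; apply/implyP => xy.
  rewrite !ffunE cS ?enum_valP ?(inj_eq inj_f) //.
  by apply: contraTneq xy => ->; rewrite adj_irr.
by case: d cardS cS copy => cardS _ copy; rewrite copy ?orbT.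
Qed.

Definition ramsey (G H : sgraph) : nat := ex_minn (ramsey_exists G H).

(* N is a combination of the entries of ps with coefficients in nat. *)
Definition linear_combination (ps : seq nat) (N : nat) : Prop :=
  exists k : nat -> nat, N = \sum_(i < size ps) k i * nth 0 ps i.

(* Main.v *)
Require Import Defs.
From mathcomp Require Import all_boot perm zify.

(** In a colouring of K_N, N = m+n-3, without a blue K_{1,m}, the red graph has
    minimum degree at least n-3.  Its components thus have at least n-2
    vertices, and one of them, G, has at least n, since N is not a combination
    of n-1 and n-2.  The tree T embeds in G, for one of two reasons.

    If non-adjacency is transitive, G is complete multipartite with parts of
    size at most |G|-n+3.  As T is neither a star nor a T(p,q), both its colour
    classes have at least three vertices; the parts of G are distributed over
    the two classes, except possibly one part which straddles them and receives
    an independent set of at most three vertices.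

    Otherwise G has a walk x, y, z, z' with x adjacent to neither z nor z'.  Any
    greedy embedding of T minus two leaves with the parent of one leaf at x and
    with z, z' in the image leaves two neighbours of x unused, so the only
    obstruction is that the parent w of the other leaf sits at a vertex without
    unused neighbours.  That vertex is then adjacent to the whole image, so w
    can be exchanged with a better placed vertex.  The double stars and the
    spiders with two long legs are embedded by hand. *)

Set Implicit Arguments.
Unset Strict Implicit.
Unset Printing Implicit Defensive.

(** * Maps with prescribed labels, and choices of disjoint sets *)

(** The element of a given rank in its class of [T] goes to the element of the same rank in the
    class of [G] with the same label. Embeddings whose adjacencies depend on labels only are thus
    obtained by counting. *)
Lemma lift_classes (T G K : finType) (h : T -> K) (k : G -> K) :
  (forall i, #|[set x | h x == i]| <= #|[set v | k v == i]|) ->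
  exists f : T -> G, injective f /\ forall x, k (f x) = h x.
Proof.
move=> le_hk.
pose P i := enum [set x | h x == i]; pose Q i := enum [set v | k v == i].
have ltQ x : index x (P (h x)) < size (Q (h x)).
  by rewrite -cardE (leq_trans _ (le_hk _)) // cardE index_mem mem_enum inE.
pose f x := tnth (in_tuple (Q (h x))) (Ordinal (ltQ x)).
have kf x : k (f x) = h x.
  by have := mem_tnth (Ordinal (ltQ x)) (in_tuple (Q (h x)));
     rewrite mem_enum inE => /eqP.
exists f; split=> // x y fxy; have hxy : h x = h y by rewrite -!kf fxy.
have nthf z : f z = nth (f x) (Q (h z)) (index z (P (h z))).
  by rewrite /f (tnth_nth (f x)).
move: fxy; rewrite nthf (nthf y) -hxy => /eqP.
rewrite nth_uniq ?enum_uniq //; last by have := ltQ y; rewrite hxy.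
move/eqP => eq_ix; rewrite -(nth_index x (_ : x \in P (h x))); last first.
  by rewrite mem_enum inE.
by rewrite eq_ix nth_index // mem_enum inE hxy.
Qed.

Lemma exists_subset_card (T : finType) (A : {set T}) k :
  k <= #|A| -> exists2 B : {set T}, B \subset A & #|B| = k.
Proof.
rewrite cardE => kA; exists [set x in take k (enum A)].
  by apply/subsetP => x; rewrite inE => /mem_take; rewrite mem_enum.
by rewrite cardsE (card_uniqP (take_uniq _ (enum_uniq _))) size_takel.
Qed.

(* Hall's theorem for two sets. *)
Lemma disjoint_choice (T : finType) (A B : {set T}) r s :
  r <= #|A| -> s <= #|B| -> r + s <= #|A :|: B| ->
  exists P Q : {set T}, [/\ P \subset A, Q \subset B, [disjoint P & Q],
    r <= #|P| & s <= #|Q|].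
Proof.
move=> rA sB rsAB; have cA := cardsID B A; have cU := cardsUI A B.
(* [Z] is just what [A :\: B] lacks to reach [r] elements; all the rest of [B] is left for [Q]. *)
have [|Z sZ cZ] := @exists_subset_card _ (A :&: B) (r - #|A :\: B|); first lia.
have ZA : Z \subset A := subset_trans sZ (subsetIl _ _).
have ZB : Z \subset B := subset_trans sZ (subsetIr _ _).
exists ((A :\: B) :|: Z), (B :\: Z); split.
- by rewrite subUset subsetDl.
- exact: subsetDl.
- rewrite disjoint_subset; apply/subsetP => x; rewrite !inE.
  by case: (x \in B) (x \in Z) => [] [].
- rewrite cardsU (_ : (A :\: B) :&: Z = set0) ?cards0; first lia.
  apply/setP=> x; rewrite !inE; have := subsetP ZB x.
  by case: (x \in Z) => [->|] //; rewrite andbF.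
- by rewrite cardsDS //; lia.
Qed.

(** * Embeddings, leaves, and connected vertex sets of a tree *)

Definition embeds (T G : sgraph) : Prop :=
  exists f : T -> G, injective f /\ forall x y, adj x y -> adj (f x) (f y).

Definition leaf_at (T : sgraph) (a u : T) := forall t, adj a t = (t == u).

Definition relin (T : sgraph) (X : {set T}) : rel T :=
  fun x y => [&& x \in X, y \in X & adj x y].

Definition conn (T : sgraph) (X : {set T}) :=
  {in X &, forall x y, connect (relin X) x y}.

Definition emb_on (T G : sgraph) (X : {set T}) (f : T -> G) :=
  {in X &, injective f} /\ {in X &, forall x y, adj x y -> adj (f x) (f y)}.

Section Trees.

Variable T : sgraph.
Implicit Types (x y t u : T) (X : {set T}).

Lemma conn1 x : conn [set x].
Proof. by move=> y z; rewrite !inE => /eqP-> /eqP->; exact: connect0. Qed.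

Lemma connU1 X x u : conn X -> u \in X -> adj x u -> conn (x |: X).
Proof.
move=> cX uX xu.
have sub : subrel (connect (relin X)) (connect (relin (x |: X))).
  apply: connect_sub => y z /and3P[yX zX yz]; apply: connect1.
  by rewrite /relin !inE yX zX yz !orbT.
have rxu : relin (x |: X) x u by rewrite /relin !inE eqxx uX xu orbT.
have rux : relin (x |: X) u x by rewrite /relin !inE eqxx uX adj_sym xu orbT.
move=> y z; rewrite !inE => /predU1P[->|yX] /predU1P[->|zX].
- exact: connect0.
- exact: connect_trans (connect1 rxu) (sub _ _ (cX _ _ uX zX)).
- exact: connect_trans (sub _ _ (cX _ _ yX uX)) (connect1 rux).
- exact: sub (cX _ _ yX zX).
Qed.

(** A path inside [X] between two neighbours of [x] would be closed to a cycle by [x]. So a vertex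
    added to a connected set has only one adjacency to respect. *)
Lemma acyc_unique (acT : acyclic T) X x u t : conn X -> x \notin X ->
  u \in X -> adj x u -> t \in X -> adj x t -> t = u.
Proof.
move=> cX xX uX xu tX xt; apply/eqP; apply: contraT => tu.
have /connectP[p0 pp0 lp0] := cX u t uX tX.
case/shortenP: pp0 lp0 => p pp up _ lp.
have pX : all (mem X) p.
  elim: p (u) pp {up lp} => //= y p IH v /andP[/and3P[_ yX _] /IH ->].
  by rewrite andbT.
case: p pp up lp pX => [_ _ /= eu|y p pp up lp pX]; first by rewrite eu eqxx in tu.
case: (acT [:: x, u, y & p]) => //; apply/andP; split.
  rewrite -[cycle _ _]/(path adj x (rcons [:: u, y & p] x)) rcons_path.
  rewrite [last _ _](esym lp) (adj_sym t) xt andbT [path _ _ _]/=.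
  by rewrite xu; apply: sub_path pp => v w /and3P[].
rewrite cons_uniq up andbT; apply: contra xX.
by rewrite inE => /predU1P[->//|/(allP pX)].
Qed.

(** Serves as induction over a connected graph: to determine all vertices it suffices to propose a
    set that no edge leaves. *)
Lemma conn_boundary (cT : connected T) X x0 : x0 \in X ->
  (forall x y, x \in X -> adj x y -> y \in X) -> forall x, x \in X.
Proof.
move=> x0X cl x; have /connectP[p pp ->] := cT.2 x0 x.
by elim: p x0 x0X pp => //= y p IH z zX /andP[/(cl _ _ zX) yX /IH]; apply.
Qed.

End Trees.

(** * Vertices of degree one in a forest *)

Section TwoEnds.

Variables (V : finType) (e : rel V).
Hypotheses (e_sym : symmetric e) (e_irr : irreflexive e).
Hypothesis e_acyc : forall s : seq V, 2 < size s -> ~ ucycle e s.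

(* The far end of a longest path from [x]. *)
Lemma exists_end x y : e x y ->
  exists z c, z != x /\ forall t, e z t = (t == c).
Proof.
move=> xy.
(* [P k]: some path with [k] vertices ends at [x]. It is listed from its far end [z], so that
   prolonging it is a cons. *)
pose P k := [exists s : k.-tuple V,
  if tval s is z :: p then [&& path e z p, uniq (z :: p) & last z p == x] else false].
have P2 : P 2.
  apply/existsP; exists [tuple y; x]; rewrite /= e_sym xy inE eqxx !andbT /=.
  by apply: contraTneq xy => ->; rewrite e_irr.
have exP : exists k, P k.
  by exists 2.
have leP k : P k -> k <= #|V|.
  case/existsP=> -[[|z p] //= sz] /and3P[_ up _].
  rewrite -(eqP sz) -[X in X <= _](@card_uniqP _ (z :: p) up); exact: max_card.
case: (ex_maxnP exP leP) => k /existsP[s] + maxk.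
case: s => -[|z [|c p]] //= sz.
  by move=> _; have /maxk := P2; rewrite -(eqP sz).
case/and3P=> /andP[zc pp] up lp.
exists z, c; split.
  apply: contraTneq up => zx; apply/nandP; left; rewrite negbK.
  by rewrite {1}zx -(eqP lp) mem_last.
move=> t; apply/idP/eqP=> [zt|->//].
have tz : t != z by apply: contraTneq zt => ->; rewrite e_irr.
(* A neighbour of [z] off the path would prolong it. *)
have tp : t \in c :: p.
  apply: contraT => tp; have /maxk : P k.+1; last by rewrite ltnn.
  apply/existsP; have szt : size [:: t, z, c & p] == k.+1 by [].
  exists (Tuple szt) => /=; rewrite zc pp lp e_sym zt /=.
  by rewrite up !andbT inE negb_or tz tp.
(* A neighbour [t] further along the path closes the cycle [z], [c], ..., [t]. *)
apply/eqP; apply: contraT => tc; move: tp; rewrite inE (negPf tc) /= => tp.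
case/splitPr: tp pp up {sz lp} => p1 p2 pp up.
case: (@e_acyc (z :: c :: rcons p1 t)) => [|]; first by rewrite /= size_rcons.
apply/andP; split.
  rewrite /= zc rcons_path last_rcons e_sym zt andbT.
  by move: pp; rewrite -cat_rcons cat_path => /andP[].
move: up; rewrite -cat_rcons -[_ && _]/(uniq ((z :: c :: rcons p1 t) ++ p2)).
by rewrite cat_uniq => /andP[].
Qed.

(** The second end is the far end of a longest path from the first, hence distinct from it. This is
    applied to the edges of [T] between non-leaves. *)
Lemma exists_two_ends x y : e x y -> exists z1 c1 z2 c2,
  [/\ z1 != z2, forall t, e z1 t = (t == c1) & forall t, e z2 t = (t == c2)].
Proof.
move=> /exists_end[z1 [c1 [_ e1]]].
have /exists_end[z2 [c2 [z21 e2]]] : e z1 c1 by rewrite e1.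
by exists z1, c1, z2, c2; rewrite eq_sym.
Qed.

End TwoEnds.

(** * Extending partial embeddings under the degree bound *)

Lemma degree_outside (G : sgraph) (F D : {set G}) v : v \in F -> v \notin D ->
    D \subset F -> (forall d, d \in D -> ~~ adj v d) ->
  degree v + #|D| < #|F| + #|[set w | adj v w] :\: F|.
Proof.
move=> vF vD DF nD; rewrite /degree -(cardsID F [set w | adj v w]).
have : #|v |: D| + #|[set w | adj v w] :&: F| <= #|F|.
  rewrite -cardsUI [X in _ + X]eq_card0 ?addn0.
    by rewrite subset_leq_card // !subUset sub1set vF DF subsetIr.
  move=> w; rewrite !inE; apply/negP => /and3P[/predU1P[->|/nD/negPf->] //].
  by rewrite adj_irr.
by rewrite cardsU1 vD; lia.
Qed.

Section Embeddings.

Variables T G : sgraph.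
Implicit Types (x y t u w : T) (X : {set T}) (f : T -> G).

Lemma emb_on_setT f : emb_on setT f -> embeds T G.
Proof.
by case=> inj_f adj_f; exists f; split=> x y; [apply: inj_f|apply: adj_f];
   rewrite inE.
Qed.

Lemma emb_on1 x f : emb_on [set x] f.
Proof.
split=> y z; rewrite !inE => /eqP-> /eqP-> //.
by rewrite adj_irr.
Qed.

Lemma card_emb_on X f : emb_on X f -> #|f @: X| = #|X|.
Proof. by case=> inj_f _; rewrite card_in_imset. Qed.

Definition upd f a (v : G) : T -> G := fun t => if t == a then v else f t.

Lemma emb_on_add X f a u v : emb_on X f -> a \notin X ->
    (forall t, t \in X -> adj a t -> t = u) -> v \notin f @: X -> adj (f u) v ->
  let g := upd f a v in [/\ emb_on (a |: X) g, {in X, g =1 f} & g @: (a |: X) = v |: f @: X].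
Proof.
move=> [inj_f adj_f] aX au vX uv g.
have gX : {in X, g =1 f}.
  by move=> t tX; rewrite /g /upd; case: eqP => // ta; rewrite -ta tX in aX.
have ga : g a = v by rewrite /g /upd eqxx.
have fv t : t \in X -> f t <> v.
  by move=> tX ftv; case/negP: vX; rewrite -ftv imset_f.
split=> //; last first.
  rewrite imsetU1 ga; congr (_ |: _); apply: eq_in_imset; exact: gX.
split=> x y; rewrite !inE => /predU1P[->|xX] /predU1P[->|yX] //.
- by rewrite ga gX // => /esym /fv.
- by rewrite ga gX // => /fv.
- by rewrite !gX //; apply: inj_f.
- by rewrite adj_irr.
- by rewrite ga gX // => ay; rewrite (au y) // adj_sym.
- by rewrite ga gX // adj_sym => ax; rewrite (au x).
- by rewrite !gX //; apply: adj_f.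
Qed.

Lemma leaf_ends X a b u : leaf_at a u -> X = ~: [set a; b] -> a != b ->
  ~~ adj a b -> u \in X.
Proof.
move=> la -> ab; rewrite la !inE negb_or [b == u]eq_sym => ->; rewrite andbT.
by apply/eqP => ua; have := la u; rewrite eqxx ua adj_irr.
Qed.

Lemma add_two_leaves f a b u w v v' : a != b -> ~~ adj a b ->
    leaf_at a u -> leaf_at b w -> emb_on (~: [set a; b]) f ->
    v \notin f @: (~: [set a; b]) -> v' \notin f @: (~: [set a; b]) ->
    adj (f u) v -> adj (f w) v' -> v != v' -> embeds T G.
Proof.
move=> ab nab la lb ef vX v'X uv wv' vv'.
have uX := leaf_ends la erefl ab nab.
have wX : w \in ~: [set a; b].
  by apply: (leaf_ends lb); rewrite 1?setUC 1?eq_sym 1?adj_sym.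
have [||||eg gX ig] := @emb_on_add _ f a u v ef.
- by rewrite !inE eqxx.
- by move=> t _; rewrite la => /eqP.
- exact: vX.
- exact: uv.
set g := upd _ _ _ in eg gX ig.
have [||||eh _ _] := @emb_on_add _ g b w v' eg.
- by rewrite !inE eqxx !orbT orbF eq_sym.
- by move=> t _; rewrite lb => /eqP.
- by rewrite ig !inE eq_sym (negPf vv').
- by rewrite gX.
apply: emb_on_setT; rewrite (_ : setT = b |: (a |: ~: [set a; b])); first exact: eh.
by apply/setP=> t; rewrite !inE; case: (t == a) (t == b) => [] [].
Qed.

Hypothesis treeT : is_tree T.
Hypothesis degG : forall v : G, #|T| <= degree v + 3.

(** While fewer than [#|T| - 2] vertices are placed, [f x] has at most [#|T| - 4] neighbours in the
    image, but degree at least [#|T| - 3]; so the next vertex always finds room. *)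
Lemma greedy X0 f0 a b u w x0 : leaf_at a u -> leaf_at b w -> a != b ->
    x0 \in X0 -> X0 \subset ~: [set a; b] -> conn X0 -> emb_on X0 f0 ->
  exists f, emb_on (~: [set a; b]) f /\ {in X0, f =1 f0}.
Proof.
set Y := ~: _ => la lb ab x0X X0Y cX0 ef0.
(* [k] bounds the number of vertices of [Y] still to be placed; the induction brings it down to
   0. *)
pose P k := exists X f, X0 \subset X /\ [/\ X \subset Y, conn X, emb_on X f,
  {in X0, f =1 f0} & #|Y| <= #|X| + k].
have cY : (#|Y| + 2 = #|T|)%N.
  by have := cardsC [set a; b]; rewrite cards2 ab -/Y; lia.
suff [X [f [_ [XY _ ef ff0 cYX]]]] : P 0.
  exists f; split=> //; suff -> : Y = X by [].
  by apply/esym/eqP; rewrite eqEcard XY; lia.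
have: P #|Y| by exists X0, f0; split=> //; split=> //; lia.
elim: #|Y| => // k IH [X [f [X0X [XY cX ef ff0 leX]]]]; apply: IH.
have [eqY|neY] := leqP #|Y| #|X|; first by exists X, f; split=> //; split=> //; lia.
have [x [y [xX yX yY xy]]] : exists x y, [/\ x \in X, y \notin X, y \in Y & adj x y].
  have [y /andP[yY yX]] : exists y, (y \in Y) && (y \notin X).
    have /subsetPn[y yY yX] : ~~ (Y \subset X).
      by apply: contraTN neY => /subset_leq_card; rewrite -leqNgt.
    by exists y; rewrite yY.
  (* If no edge leads from [X] to the rest of [Y], then [X] with those of the leaves [a], [b] that
     hang from it is closed under adjacency, hence everything. *)
  pose X' := X :|: [set t in [set a; b] | [exists x in X, adj x t]].
  have [/existsP[p]|/existsPn noxy] := boolP [exists p : T * T,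
      [&& p.1 \in X, p.2 \notin X, p.2 \in Y & adj p.1 p.2]].
    by case: p => p q /and4P[*]; exists p, q.
  case/negP: (yX); suff: y \in X'.
    by move: yY; rewrite !inE => /negPf-> /=; rewrite orbF.
  apply: (conn_boundary treeT.1 (x0 := x0)).
    by rewrite inE (subsetP X0X).
  have lf t : t \in [set a; b] -> forall p q, adj t p -> adj t q -> p = q.
    by rewrite !inE => /orP[]/eqP-> p q; rewrite ?la ?lb => /eqP-> /eqP->.
  move=> t z; rewrite in_setU => /orP[tX|].
    move=> tz; rewrite !in_setU; have [//|zX] := boolP (z \in X).
    have := noxy (t, z); rewrite /= tX zX tz andbT /= !inE negbK => ->.
    by apply/existsP; exists t; rewrite tX.
  rewrite inE => /andP[tab /existsP[x /andP[xX xt]]] tz.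
  by rewrite inE (lf t tab z x) ?xX // adj_sym.
have fyE : #|f @: X| = #|X| := card_emb_on ef.
have [v] : exists v, v \in [set v | adj (f x) v] :\: f @: X.
  apply/card_gt0P; have := degG (f x).
  rewrite /degree -(cardsID (f @: X) [set v | _]).
  have : #|[set v | adj (f x) v] :&: f @: X| < #|f @: X|.
    apply: proper_card; apply/properP; split; first exact: subsetIr.
    by exists (f x); rewrite ?imset_f // !inE adj_irr.
  lia.
rewrite !inE => /andP[vX xv].
have [||||eg gX ig] := @emb_on_add _ f y x v ef.
- exact: yX.
- by move=> t tX; apply: (acyc_unique treeT.2 cX yX xX _ tX); rewrite adj_sym.
- exact: vX.
- exact: xv.
exists (y |: X), (upd f y v); split; last split=> //.
- by apply: subset_trans X0X _; apply: subsetUr.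
- by rewrite subUset sub1set yY.
- by apply: connU1 xX _; rewrite // adj_sym.
- by move=> t tX0; rewrite gX ?ff0 // (subsetP X0X).
- by rewrite cardsU1 yX; lia.
Qed.

End Embeddings.

(** * Embeddings that use a walk whose first vertex misses the last two *)

Section Walk.

Variables T G : sgraph.
Hypothesis treeT : is_tree T.
Hypothesis degG : forall v : G, #|T| <= degree v + 3.

Lemma grow (X : {set T}) (f : T -> G) a u v : conn X -> emb_on X f ->
    u \in X -> a \notin X -> adj a u -> v \notin f @: X -> adj (f u) v ->
  [/\ conn (a |: X), emb_on (a |: X) (upd f a v), {in X, upd f a v =1 f},
    upd f a v a = v & upd f a v @: (a |: X) = v |: f @: X].
Proof.
move=> cX ef uX aX au vX uv.
have [|||eg gX ig] := @emb_on_add _ _ X f a u v ef aX.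
- by move=> t tX; apply: (acyc_unique treeT.2 cX).
- exact: vX.
- exact: uv.
split=> //; first exact: connU1 uX au.
by rewrite /upd eqxx.
Qed.

Variables x y z z' : G.
Hypotheses (xy : adj x y) (yz : adj y z) (zz' : adj z z').
Hypotheses (nxz : ~~ adj x z) (nxz' : ~~ adj x z').

Let xDy : x != y. Proof. by apply: contraTneq xy => ->; rewrite adj_irr. Qed.
Let yDz : y != z. Proof. by apply: contraTneq yz => ->; rewrite adj_irr. Qed.
Let zDz' : z != z'. Proof. by apply: contraTneq zz' => ->; rewrite adj_irr. Qed.
Let xDz : x != z. Proof. by apply: contraNneq nxz' => ->. Qed.
Let xDz' : x != z'. Proof. by apply: contraNneq nxz => ->; rewrite adj_sym. Qed.
Let yDz' : y != z'. Proof. by apply: contraTneq xy => ->. Qed.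

Section TwoLeaves.

Variables a b u w : T.
Hypotheses (la : leaf_at a u) (lb : leaf_at b w) (ab : a != b).
Let Y := ~: [set a; b].
Hypotheses (uY : u \in Y) (wY : w \in Y).

Let cardY : (#|Y| + 2 = #|T|)%N.
Proof. by rewrite -(cardsC [set a; b]) cards2 ab addnC. Qed.

Let nab : ~~ adj a b.
Proof. by rewrite la; apply: contraTneq uY => <-; rewrite !inE eqxx orbT. Qed.

Lemma out_or_full (f : T -> G) s t : emb_on Y f -> s \in Y -> t \in Y -> s != t ->
  ~~ adj (f s) (f t) -> exists2 v, v \notin f @: Y & adj (f s) v.
Proof.
move=> ef sY tY st nst.
have lt : degree (f s) + #|[set f t]| < #|f @: Y| + #|[set r | adj (f s) r] :\: f @: Y|.
  apply: degree_outside.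
  - exact: imset_f.
  - by rewrite inE; apply: contraNneq st => /(ef.1 _ _ sY tY)->.
  - by rewrite sub1set imset_f.
  - by move=> d; rewrite inE => /eqP->.
rewrite cards1 (card_emb_on ef) in lt; have ds := degG (f s).
have /card_gt0P[v] : 0 < #|[set w : G | adj (f s) w] :\: f @: Y|
  by move: lt ds cardY; clear; lia.
by rewrite !inE => /andP[vY sv]; exists v.
Qed.

Lemma out_of_x (f : T -> G) v' : emb_on Y f -> f u = x -> z \in f @: Y -> z' \in f @: Y ->
  exists v, [/\ v \notin f @: Y, adj x v & v != v'].
Proof.
move=> ef fu zY z'Y.
have lt : degree x + #|[set z; z']| < #|f @: Y| + #|[set r | adj x r] :\: f @: Y|.
  apply: degree_outside.
  - by rewrite -fu imset_f.
  - by rewrite !inE negb_or xDz.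
  - by rewrite subUset !sub1set zY.
  - by move=> d; rewrite !inE => /orP[]/eqP->.
rewrite cards2 zDz' (card_emb_on ef) in lt; have ds := degG x.
have /card_gt1P[v1 [v2]] : 1 < #|[set w : G | adj x w] :\: f @: Y|
  by move: lt ds cardY; clear; lia.
rewrite !inE => -[/andP[v1Y xv1] /andP[v2Y xv2] v12].
have [v1v'|] := eqVneq v1 v'; last by exists v1.
by exists v2; rewrite -v1v' eq_sym.
Qed.

Lemma embeds_two_leaves (f : T -> G) v' : emb_on Y f -> f u = x -> z \in f @: Y ->
  z' \in f @: Y -> v' \notin f @: Y -> adj (f w) v' -> embeds T G.
Proof.
move=> ef fu zY z'Y v'Y wv'.
have [v [vY xv vv']] := out_of_x v' ef fu zY z'Y.
by apply: (add_two_leaves ab nab la lb ef vY v'Y _ wv' vv'); rewrite fu.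
Qed.

Lemma embeds_spider c t1 : adj u c -> adj w c -> adj t1 c -> u != w ->
    t1 != u -> t1 != w -> c \in Y -> t1 \in Y ->
    (forall t, t \in Y -> t != c -> adj c t) ->
  embeds T G.
Proof.
move=> uc wc tc uw tu tw cY tY star.
have irr p q : adj p q -> p != q.
  by move=> pq; apply: contraTneq pq => ->; rewrite adj_irr.
have [|||||c1 e1 g1 h1 i1] := @grow [set c] (fun=> y) u c x (@conn1 T c) (emb_on1 _ _).
- by rewrite inE.
- by rewrite inE irr.
- exact: uc.
- by rewrite imset_set1 inE.
- by rewrite adj_sym.
set f1 := upd _ _ _ in e1 g1 h1 i1.
have f1c : f1 c = y by rewrite g1 ?inE.
have [|||||c2 e2 g2 h2 i2] := @grow _ f1 w c z c1 e1.
- by rewrite !inE eqxx orbT.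
- by rewrite !inE negb_or (irr _ _ _ wc) eq_sym uw.
- exact: wc.
- by rewrite i1 imset_set1 !inE negb_or ![z == _]eq_sym xDz.
- by rewrite f1c.
set f2 := upd _ _ _ in e2 g2 h2 i2.
have f2c : f2 c = y by rewrite g2 ?f1c // !inE eqxx orbT.
have f2u : f2 u = x by rewrite g2 // !inE eqxx.
have zout f : emb_on Y f -> f u = x -> f w = z ->
    exists2 v, v \notin f @: Y & adj (f w) v.
  move=> ef fu fw; apply: (out_or_full ef wY uY); first by rewrite eq_sym.
  by rewrite fw fu adj_sym.
have [yz'|nyz'] := boolP (adj y z').
  have [|||||c3 e3 g3 h3 i3] := @grow _ f2 t1 c z' c2 e2.
  - by rewrite !inE eqxx !orbT.
  - by rewrite !inE !negb_or tw tu (irr _ _ _ tc).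
  - exact: tc.
  - by rewrite i2 i1 imset_set1 !inE !negb_or ![z' == _]eq_sym zDz' xDz'.
  - by rewrite f2c.
  set f3 := upd _ _ _ in e3 g3 h3 i3.
  have [||f [ef ff3]] := greedy (x0 := u) treeT degG la lb ab _ _ c3 e3.
  - by rewrite !inE eqxx !orbT.
  - by rewrite !subUset !sub1set uY cY wY tY.
  have fu : f u = x by rewrite ff3 ?g3 // !inE eqxx !orbT.
  have fw : f w = z by rewrite ff3 ?g3 ?h2 // !inE eqxx ?orbT.
  have ft : f t1 = z' by rewrite ff3 ?h3 // !inE eqxx.
  have [r rY wr] := zout f ef fu fw.
  apply: (embeds_two_leaves ef fu _ _ rY wr); first by rewrite -fw imset_f.
  by rewrite -ft imset_f.
have [||f [ef ff2]] := greedy (x0 := u) treeT degG la lb ab _ _ c2 e2.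
- by rewrite !inE eqxx !orbT.
- by rewrite !subUset !sub1set uY cY wY.
have fu : f u = x by rewrite ff2 ?f2u // !inE eqxx !orbT.
have fw : f w = z by rewrite ff2 ?h2 // !inE eqxx.
have fc : f c = y by rewrite ff2 ?f2c // !inE eqxx !orbT.
(* The image consists of [y] and neighbours of [y]. So [z'] is free to receive [b], and it cannot be
   the place of [a], as [x] misses it. *)
have z'F : z' \notin f @: Y.
  apply/imsetP => -[t tY' z't]; have [tc'|tc'] := eqVneq t c.
    by move: yDz'; rewrite z't tc' fc eqxx.
  by case/negP: nyz'; rewrite z't -fc; apply: ef.2 => //; apply: star.
have [v vF xv] : exists2 v, v \notin f @: Y & adj (f u) v.
  by apply: (out_or_full ef uY wY uw); rewrite fu fw.
apply: (add_two_leaves ab nab la lb ef vF z'F xv); first by rewrite fw.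
by apply: contraTneq xv => ->; rewrite fu.
Qed.

Variables c v v' : T.
Hypotheses (uc : adj u c) (cv : adj c v) (vv' : adj v v').
Hypotheses (uv : u != v) (cv' : c != v').
Hypotheses (cY : c \in Y) (vY : v \in Y) (v'Y : v' \in Y).

(** The path [u], [c], [v], [v'] is laid on the walk, and [greedy] places the other vertices. *)
Lemma emb_walk : exists f : T -> G, emb_on Y f /\ [/\ f u = x, f c = y, f v = z & f v' = z'].
Proof.
have cu : c != u by apply: contraTneq uc => ->; rewrite adj_irr.
have vc : v != c by apply: contraTneq cv => ->; rewrite adj_irr.
have v'v : v' != v by apply: contraTneq vv' => ->; rewrite adj_irr.
have [|||||c1 e1 g1 h1 i1] := @grow [set u] (fun=> x) c u y (@conn1 T u) (emb_on1 _ _).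
- by rewrite inE.
- by rewrite inE.
- by rewrite adj_sym.
- by rewrite imset_set1 inE eq_sym.
- exact: xy.
set f1 := upd _ _ _ in e1 g1 h1 i1.
have f1u : f1 u = x by rewrite g1 ?inE.
have [|||||c2 e2 g2 h2 i2] := @grow _ f1 v c z c1 e1.
- by rewrite !inE eqxx.
- by rewrite !inE negb_or vc eq_sym.
- by rewrite adj_sym.
- by rewrite i1 imset_set1 !inE negb_or ![z == _]eq_sym yDz.
- by rewrite h1.
set f2 := upd _ _ _ in e2 g2 h2 i2.
have f2c : f2 c = y by rewrite g2 ?inE ?eqxx.
have f2u : f2 u = x by rewrite g2 ?f1u // !inE eqxx orbT.
(* If [v'] were [u], then [u], [c], [v] would form a triangle. *)
have v'X : v' \notin [set v; c; u].
  rewrite !inE (negPf v'v) eq_sym (negPf cv') /=.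
  apply: contraTneq vv' => ->; apply: contraTN uc => vu.
  have := acyc_unique treeT.2 c1 (x := v) (u := u) (t := c).
  rewrite !inE !eqxx /= orbT negb_or vc eq_sym uv vu adj_sym cv.
  by move=> /(_ isT isT isT isT isT) cu'; rewrite cu' eqxx in cu.
have [|||||c3 e3 g3 h3 i3] := @grow _ f2 v' v z' c2 e2.
- by rewrite !inE eqxx.
- by move: v'X; rewrite !inE -orbA.
- by rewrite adj_sym.
- by rewrite i2 i1 imset_set1 !inE !negb_or ![z' == _]eq_sym zDz' yDz'.
- by rewrite h2.
set f3 := upd _ _ _ in e3 g3 h3 i3.
have [||f [ef ff3]] := greedy (x0 := u) treeT degG la lb ab _ _ c3 e3.
- by rewrite !inE eqxx !orbT.
- by rewrite !subUset !sub1set uY cY vY v'Y.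
exists f; split=> //.
by rewrite !ff3 ?inE ?eqxx ?orbT // h3 !g3 ?inE ?eqxx ?orbT // h2 f2c f2u.
Qed.

(** The old position of [w] sees the whole image, so [t] can move there. In [Y], [w] has the single
    neighbour [w0], so its new position need only see that of [w0]; when [t] is [w0], the latter is
    the old position of [w]. *)
Lemma swap_emb (f : T -> G) t w0 : emb_on Y f -> t \in Y -> t != w -> w0 != w -> w0 \in Y ->
    (forall q, q \in Y -> adj w q -> q = w0) ->
    (forall s, s \in Y -> s != w -> adj (f w) (f s)) ->
    t = w0 \/ adj (f w0) (f t) ->
  emb_on Y (f \o tperm w t) /\ (f \o tperm w t) @: Y = f @: Y.
Proof.
move=> [inj_f adj_f] tY tw w0w w0Y wq full tw0.
have pY s : s \in Y -> tperm w t s \in Y by case: tpermP => [->|->|].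
split; last first.
  apply/setP=> r; apply/imsetP/imsetP => -[s sY ->].
    by exists (tperm w t s); rewrite ?pY.
  by exists (tperm w t s); rewrite ?pY //= tpermK.
split=> [p q pY' qY|]; first by move/inj_f/perm_inj; apply; rewrite ?pY.
have main p q : p \in Y -> q \in Y -> adj p q -> p = w \/ p = t ->
    adj (f (tperm w t p)) (f (tperm w t q)).
  move=> pY' qY pq [pw|pt].
    move: pq; rewrite pw tpermL => /(wq _ qY)->; case: tw0 => [<-|w0t].
      by rewrite tpermR adj_sym full.
    have w0t' : w0 != t by apply: contraTneq w0t => ->; rewrite adj_irr.
    by rewrite tpermD 1?eq_sym // adj_sym.
  rewrite pt tpermR; apply: full; first exact: pY.
  rewrite -{2}(tpermR w t) (inj_eq perm_inj).
  by apply: contraTneq pq => ->; rewrite pt adj_irr.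
move=> p q pY' qY pq /=.
have [pw|pw] := eqVneq p w; first by apply: main; auto.
have [pt|pt] := eqVneq p t; first by apply: main; auto.
have [qw|qw] := eqVneq q w; first by rewrite adj_sym; apply: main; rewrite 1?adj_sym; auto.
have [qt|qt] := eqVneq q t; first by rewrite adj_sym; apply: main; rewrite 1?adj_sym; auto.
by rewrite !tpermD 1?eq_sym //; apply: adj_f.
Qed.

Lemma embeds_thin_end w0 : (forall t, adj w t = (t == b) || (t == w0)) ->
  w0 != b -> w != u -> w0 != u -> embeds T G.
Proof.
move=> Nw w0b wu w0u; have [f [ef [fu fc fv fv']]] := emb_walk.
have zF : z \in f @: Y by rewrite -fv imset_f.
have z'F : z' \in f @: Y by rewrite -fv' imset_f.
have full_or s : s \in Y -> (exists2 r, r \notin f @: Y & adj (f s) r) \/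
    forall t, t \in Y -> t != s -> adj (f s) (f t).
  move=> sY; have [/existsP[t /and3P[tY ts nst]]|/existsPn no] := boolP
      [exists t, [&& t \in Y, t != s & ~~ adj (f s) (f t)]].
    by left; apply: (out_or_full ef sY tY); rewrite // eq_sym.
  right=> t tY ts; have := no t; rewrite tY ts negbK; exact.
have [[r rF wr]|wfull] := full_or w wY; first exact: embeds_two_leaves ef fu zF z'F rF wr.
have ww0 : adj w w0 by rewrite Nw eqxx orbT.
have w0w : w0 != w by apply: contraTneq ww0 => ->; rewrite adj_irr.
have w0a : w0 != a.
  apply: contraNneq wu => w0a; move: ww0; rewrite w0a adj_sym la; exact: id.
have w0Y : w0 \in Y by rewrite !inE negb_or w0a.
have wq q : q \in Y -> adj w q -> q = w0.
  by rewrite Nw => qY /orP[]/eqP // qb; rewrite qb !inE eqxx orbT in qY.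
have swap t : t \in Y -> t != w -> t != u -> t = w0 \/ adj (f w0) (f t) ->
    (exists2 r, r \notin f @: Y & adj (f t) r) -> embeds T G.
  move=> tY tw tu tw0 [r rF tr].
  have [eg ig] := swap_emb ef tY tw w0w w0Y wq wfull tw0.
  apply: (embeds_two_leaves (v' := r) eg); rewrite ?ig //=.
    by rewrite tpermD.
  by rewrite tpermL.
(* The first candidate for the exchange is [w0]. *)
have [out0|full0] := full_or w0 w0Y; first by apply: swap out0; auto.
have zx : ~~ adj z x by rewrite adj_sym.
have vw : v != w.
  apply: contraNneq zx => vw; rewrite -fv vw -fu; apply: wfull => //.
  by rewrite eq_sym.
apply: (swap v) => //; first by rewrite eq_sym.
  by have [->|] := eqVneq v w0; [left|right; apply: full0].
by apply: (out_or_full ef vY uY); rewrite 1?eq_sym ?fv ?fu.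
Qed.

End TwoLeaves.

Lemma embeds_twin_leaves (a b u c v v' : T) : leaf_at a u -> leaf_at b u -> a != b ->
    adj u c -> adj c v -> adj v v' -> u != v -> c != v' ->
  embeds T G.
Proof.
move=> la lb ab uc cv vv' uv cv'.
have two p q r l k : leaf_at l k -> adj p q -> adj q r -> p != r -> q != l.
  move=> ll pq qr pr; apply: contraNneq pr => ql.
  by move: pq qr; rewrite ql adj_sym !ll => /eqP-> /eqP->.
have vu : v != u by rewrite eq_sym.
have in_Y t : t != a -> t != b -> t \in ~: [set a; b] by rewrite !inE negb_or => ->.
have un l : leaf_at l u -> u != l.
  by move=> ll; apply: contraTneq uc => e; have := ll u; rewrite e eqxx adj_irr.
have vl l : leaf_at l u -> v' != l.
  by move=> ll; apply: contraTneq vv' => ->; rewrite adj_sym ll.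
have uY : u \in ~: [set a; b] by apply: in_Y; apply: un.
have [|||f [ef [fu fc fv fv']]] := emb_walk la lb ab uY uc cv vv' uv cv'.
- by apply: in_Y; [apply: two la uc cv uv|apply: two lb uc cv uv].
- by apply: in_Y; [apply: two la cv vv' cv'|apply: two lb cv vv' cv'].
- by apply: in_Y; apply: vl.
have zF : z \in f @: ~: [set a; b].
  rewrite -fv imset_f //.
  by apply: in_Y; [apply: two la cv vv' cv'|apply: two lb cv vv' cv'].
have z'F : z' \in f @: ~: [set a; b].
  by rewrite -fv' imset_f //; apply: in_Y; apply: vl.
(* The vertex to be avoided is a dummy here, so [x] itself is given. *)
have [r [rF xr _]] := out_of_x ab uY x ef fu zF z'F.
by apply: (embeds_two_leaves la lb ab uY ef fu zF z'F rF); rewrite fu.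
Qed.

End Walk.

(** * Double stars *)

Section DoubleStar.

Variables T G : sgraph.
Hypothesis degT : forall t : T, degree t + 3 <= #|T|.
Hypothesis degG : forall v : G, #|T| <= degree v + 3.

(** Besides at least [#|T| - 3] neighbours of [P], the union contains [P], [r1] and [r2]. *)
Lemma wide_edge (P Q r1 r2 : G) : adj P Q -> adj Q r1 -> adj Q r2 -> r1 != r2 ->
    ~~ adj P r1 -> ~~ adj P r2 -> r1 != P -> r2 != P ->
  #|T| <= #|[set v | adj P v] :|: [set v | adj Q v]|.
Proof.
move=> PQ Qr1 Qr2 r12 nr1 nr2 r1P r2P; apply: leq_trans (degG P) _.
have sub : r1 |: (r2 |: (P |: [set v | adj P v])) \subset
    [set v | adj P v] :|: [set v | adj Q v].
  rewrite !subUset !sub1set !inE Qr1 Qr2 (adj_sym Q) PQ !orbT.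
  exact: subsetUl.
have := subset_leq_card sub; rewrite !cardsU1 !inE adj_irr.
rewrite (negPf r12) (negPf r1P) (negPf r2P) (negPf nr1) (negPf nr2) /= -/(degree P).
by rewrite !add1n addn3.
Qed.

(** The centres go to [P] and [Q], and [disjoint_choice] finds room for their leaves: the degrees in
    [T] do not exceed those in [G], and the edge [P], [Q] is wide enough for all leaves together. *)
Lemma embeds_double_star (p q : T) (P Q : G) : adj p q ->
    (forall t, t != p -> t != q -> leaf_at t p \/ leaf_at t q) ->
    adj P Q -> #|T| <= #|[set v | adj P v] :|: [set v | adj Q v]| ->
  embeds T G.
Proof.
move=> pq lpq PQ le_T.
have pDq : p != q by apply: contraTneq pq => ->; rewrite adj_irr.
have PDQ : P != Q by apply: contraTneq PQ => ->; rewrite adj_irr.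
pose A := [set v | adj P v] :\ Q; pose B := [set v | adj Q v] :\ P.
pose C := [set t | adj p t] :\ q; pose D := [set t | adj q t] :\ p.
have cA : degree P = #|A|.+1 by rewrite /degree (cardsD1 Q) inE PQ.
have cB : degree Q = #|B|.+1 by rewrite /degree (cardsD1 P) inE adj_sym PQ.
have cC : degree p = #|C|.+1 by rewrite /degree (cardsD1 q) inE pq.
have cD : degree q = #|D|.+1 by rewrite /degree (cardsD1 p) inE adj_sym pq.
have cAB : #|T| <= #|A :|: B| + 2.
  apply: leq_trans le_T _.
  have -> : [set v | adj P v] :|: [set v | adj Q v] = [set P; Q] :|: (A :|: B).
    apply/setP=> v; rewrite !inE; have [->|vP] := eqVneq v P.
      by rewrite (adj_sym Q) PQ orbT.
    by have [->|vQ] := eqVneq v Q; rewrite ?PQ ?orbT.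
  by rewrite (leq_trans (leq_card_setU _ _)) // cards2 PDQ addnC.
have cCD : #|C| + #|D| + 2 = #|T|.
  have <- : #|[set p; q] :|: (C :|: D)| = #|T|.
    rewrite -cardsT; apply: eq_card => t; rewrite !inE.
    have [->|tp] := eqVneq t p; first by [].
    have [->|tq] := eqVneq t q; first by rewrite orbT.
    by case: (lpq t tp tq) => lt; rewrite ![adj _ t]adj_sym !lt eqxx ?orbT.
  rewrite cardsU cards2 pDq (_ : _ :&: _ = set0); last first.
    apply/setP=> t; rewrite !inE; have [->|_] := eqVneq t p.
      by rewrite adj_irr !andbF.
    by have [->|//] := eqVneq t q; rewrite adj_irr.
  rewrite cards0 subn0 cardsU (_ : _ :&: _ = set0) ?cards0 ?subn0 1?addnC //.
  apply/setP=> t; rewrite !inE; have [->|tp] := eqVneq t p; first by rewrite andbF.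
  have [//|tq] := eqVneq t q.
  case: (lpq t tp tq) => lt; rewrite ![adj _ t]adj_sym !lt eqxx.
    by rewrite (eq_sym q) (negPf pDq).
  by rewrite (negPf pDq).
have [|||P' [Q' [PA QB PQ' cP cQ]]] := @disjoint_choice _ A B #|C| #|D|.
- by have := degT p; have := degG P; move: cA cC; clear; lia.
- by have := degT q; have := degG Q; move: cB cD; clear; lia.
- by move: cAB cCD; clear; lia.
pose h t := if t == p then Some (true, true) else if t == q then Some (false, true)
  else Some (adj p t, false).
pose k v := if v == P then Some (true, true) else if v == Q then Some (false, true)
  else if v \in P' then Some (true, false)
  else if v \in Q' then Some (false, false) else None.
have hE t : h t = Some (true, false) -> t \in C.
  rewrite /h !inE; case: (t == p) (t == q) => [] [] //.
  by case: (adj p t).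
have hE' t : h t = Some (false, false) -> t \in D.
  rewrite /h !inE; case: eqP => [//|/eqP tp]; case: eqP => [//|/eqP tq] [].
  by case: (lpq t tp tq) => lt; rewrite ![adj _ t]adj_sym !lt eqxx.
have kP v : v \in P' -> k v = Some (true, false).
  move=> vP; have := subsetP PA v vP; rewrite !inE /k vP => /andP[/negPf-> Pv].
  by case: eqP => // vP'; rewrite vP' adj_irr in Pv.
have kQ v : v \in Q' -> k v = Some (false, false).
  move=> vQ; have := subsetP QB v vQ; rewrite !inE /k vQ => /andP[/negPf-> Qv].
  rewrite (disjointFl PQ' vQ); case: eqP => // vQ'; by rewrite vQ' adj_irr in Qv.
have [|f [inj_f kf]] := @lift_classes T G _ h k.
  move=> [[[] []]|].
  - rewrite (@eq_card1 _ p) => [|t].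
      by apply/card_gt0P; exists P; rewrite inE /k eqxx.
    by rewrite !inE /h; case: (t == p) (t == q) => [] [] //; case: (adj p t).
  - apply: leq_trans (subset_leq_card (_ : _ \subset C)) _.
      by apply/subsetP => t; rewrite inE => /eqP/hE.
    apply: leq_trans cP (subset_leq_card _).
    by apply/subsetP => v vP; rewrite inE kP.
  - rewrite (@eq_card1 _ q) => [|t].
      by apply/card_gt0P; exists Q; rewrite inE /k eqxx (eq_sym Q) (negPf PDQ).
    rewrite !inE /h; have [->|_] := eqVneq t p; first by rewrite (negPf pDq).
    by case: (t == q) => //; case: (adj p t).
  - apply: leq_trans (subset_leq_card (_ : _ \subset D)) _.
      by apply/subsetP => t; rewrite inE => /eqP/hE'.
    apply: leq_trans cQ (subset_leq_card _).
    by apply/subsetP => v vQ; rewrite inE kQ.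
  - rewrite eq_card0 // => t; rewrite !inE /h.
    by case: (t == p) (t == q) => [] [].
exists f; split=> //.
have kinv v : [/\ k v = Some (true, true) -> v = P, k v = Some (false, true) -> v = Q,
    k v = Some (true, false) -> v \in P' & k v = Some (false, false) -> v \in Q'].
  rewrite /k; case: eqP => // _; case: eqP => // _.
  by case: (v \in P') (v \in Q') => [] [].
have fp : f p = P.
  by have [+ _ _ _] := kinv (f p); apply; rewrite kf /h eqxx.
have fq : f q = Q.
  by have [_ + _ _] := kinv (f q); apply; rewrite kf /h eqxx (eq_sym q) (negPf pDq).
have adjp t : adj p t -> adj (f p) (f t).
  move=> pt; have [->|tq] := eqVneq t q; first by rewrite fp fq.
  have tp : t != p by apply: contraTneq pt => ->; rewrite adj_irr.
  have [_ _ + _] := kinv (f t); rewrite kf /h pt (negPf tp) (negPf tq) fp.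
  by move=> /(_ erefl) /(subsetP PA); rewrite !inE => /andP[].
have adjq t : adj q t -> adj (f q) (f t).
  move=> qt; have [->|tp] := eqVneq t p; first by rewrite fp fq adj_sym.
  have tq : t != q by apply: contraTneq qt => ->; rewrite adj_irr.
  have npt : adj p t = false.
    case: (lpq t tp tq) => lt; last by rewrite adj_sym lt (negPf pDq).
    by move: qt; rewrite adj_sym lt (eq_sym q) (negPf pDq).
  have [_ _ _ +] := kinv (f t); rewrite kf /h npt (negPf tp) (negPf tq) fq.
  by move=> /(_ erefl) /(subsetP QB); rewrite !inE => /andP[].
move=> s t st; have [sp|sp] := eqVneq s p; first by rewrite sp adjp // -sp.
have [sq|sq] := eqVneq s q; first by rewrite sq adjq // -sq.
rewrite adj_sym; case: (lpq s sp sq) => ls; move: (st); rewrite ls => /eqP tE.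
  by rewrite tE adjp // -tE adj_sym.
by rewrite tE adjq // -tE adj_sym.
Qed.

End DoubleStar.

(** * Every admissible tree embeds when such a walk exists *)

Section WalkCase.

Variables T G : sgraph.
Hypothesis treeT : is_tree T.
Hypothesis cardT : 6 <= #|T|.
Hypothesis degT : forall t : T, degree t + 3 <= #|T|.
Hypothesis degG : forall v : G, #|T| <= degree v + 3.
Variables x y z z' : G.
Hypotheses (xy : adj x y) (yz : adj y z) (zz' : adj z z').
Hypotheses (nxz : ~~ adj x z) (nxz' : ~~ adj x z').

(** In each case some edge has an end that misses two neighbours of the other end, and [wide_edge]
    applies. *)
Lemma exists_wide_edge : exists P Q : G, adj P Q /\
  #|T| <= #|[set v | adj P v] :|: [set v | adj Q v]|.
Proof.
have xDz : x != z by apply: contraNneq nxz' => ->.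
have xDz' : x != z' by apply: contraNneq nxz => ->; rewrite adj_sym.
have yDz' : y != z' by apply: contraTneq xy => ->.
have zDz' : z != z' by apply: contraTneq zz' => ->; rewrite adj_irr.
have [yz'|nyz'] := boolP (adj y z').
  by exists x, y; split=> //; apply: (wide_edge degG xy yz yz'); rewrite // 1?eq_sym.
(* As [6 <= #|T|], the degree of [y] is at least 3. *)
have [v] : exists v, v \in [set v | adj y v] :\: [set x; z].
  apply/card_gt0P; have := degG y; rewrite /degree.
  have := cardsID [set x; z] [set v | adj y v].
  have := subset_leq_card (subsetIr [set v | adj y v] [set x; z]).
  by rewrite cards2 xDz; move: cardT; clear; lia.
rewrite !inE negb_or -andbA => /and3P[vx vz yv].
have vz' : v != z' by apply: contraNneq nyz' => <-.
have vy : v != y by apply: contraTneq yv => ->; rewrite adj_irr.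
have [xv|nxv] := boolP (adj x v); last first.
  by exists x, y; split=> //; apply: (wide_edge degG xy yz yv); rewrite // 1?eq_sym.
have [zv|nzv] := boolP (adj z v); last first.
  exists z, y; split; first by rewrite adj_sym.
  apply: (wide_edge degG _ _ yv (r1 := x)); rewrite // 1?adj_sym // 1?eq_sym //.
have [z'v|nz'v] := boolP (adj z' v); last first.
  exists z', z; split; first by rewrite adj_sym.
  apply: (wide_edge degG _ _ zv (r1 := y)); rewrite // 1?adj_sym // 1?eq_sym //.
exists x, v; split=> //.
by apply: (wide_edge degG xv (r1 := z) (r2 := z')); rewrite // 1?adj_sym // 1?eq_sym.
Qed.

(** The edges of the tree left after deleting all leaves of [T]. *)
Let e : rel T := fun p q => [&& adj p q, 1 < degree p & 1 < degree q].

Lemma leafP (t u : T) : degree t <= 1 -> adj t u -> leaf_at t u.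
Proof.
move=> t1 tu s; apply/idP/eqP=> [ts|->//].
by apply: (card_le1_eqP t1); rewrite inE.
Qed.

Lemma leaf_degree (a u : T) : leaf_at a u -> degree a = 1.
Proof.
by move=> la; rewrite /degree (@eq_card1 _ u) // => t; rewrite !inE la.
Qed.

Lemma edge_nonleaf (p q : T) : adj p q -> 1 < degree p -> ~~ e p q -> leaf_at q p.
Proof.
move=> pq p1; rewrite /e pq p1 /= -leqNgt => q1.
by apply: leafP; rewrite // adj_sym.
Qed.

(** Otherwise [T] is a star, whose centre violates [degT]. *)
Lemma exists_nonleaf_edge : exists p q, e p q.
Proof.
have [/existsP[p /existsP[q pq]]|/existsPn no] := boolP [exists p, exists q, e p q].
  by exists p, q.
have {}no p q : ~~ e p q by have /existsPn := no p.
have [v lv] : exists v : T, forall t, adj v t -> leaf_at t v.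
  have [/existsP[v v1]|/existsPn no1] := boolP [exists v : T, 1 < degree v].
    by exists v => t vt; apply: edge_nonleaf.
  have /card_gt0P[v _] : 0 < #|T| by apply: leq_trans cardT.
  by exists v => t vt; apply: leafP; rewrite 1?adj_sym // leqNgt.
have all t : t \in v |: [set t | adj v t].
  apply: (conn_boundary treeT.1 (x0 := v)); first by rewrite !inE eqxx.
  move=> p q; rewrite !inE => /orP[/eqP->->|vp]; first by rewrite orbT.
  by rewrite (lv p vp) => /eqP->; rewrite eqxx.
have : #|T| <= #|v |: [set t | adj v t]|.
  by rewrite -cardsT; apply/subset_leq_card/subsetP => t _.
by rewrite cardsU1 !inE adj_irr -/(degree v); have := degT v; clear; lia.
Qed.

(** Here [u] and [c] are the only non-leaves, so [T] is a double star. *)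
Lemma embeds_adjacent_ends u c : (forall t, e u t = (t == c)) ->
  (forall t, e c t -> t = u) -> embeds T G.
Proof.
move=> eu ec; have : e u c by rewrite eu.
case/and3P=> uc u1 c1.
have lu t : adj u t -> t != c -> leaf_at t u.
  by move=> ut tc; apply: edge_nonleaf; rewrite ?eu.
have lc t : adj c t -> t != u -> leaf_at t c.
  move=> ct tu; apply: edge_nonleaf => //.
  by apply: contraNN tu => /ec->.
have all t : t \in [set t | adj u t] :|: [set t | adj c t].
  apply: (conn_boundary treeT.1 (x0 := u)); first by rewrite !inE (adj_sym c) uc orbT.
  move=> p q; rewrite !inE; have [-> _ ->|pu] := eqVneq p u; first by [].
  have [-> _ ->|pc] := eqVneq p c; first by rewrite orbT.
  move=> /orP[/lu/(_ pc)->|/lc/(_ pu)->] /eqP->; last by rewrite uc.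
  by rewrite (adj_sym c) uc orbT.
have [P [Q [PQ wide]]] := exists_wide_edge.
apply: (embeds_double_star degT degG uc _ PQ wide) => t tu tc.
by have := all t; rewrite !inE => /orP[/lu|/lc]; auto.
Qed.

(** Two leaves at [u] fall under [embeds_twin_leaves], and the absence of a further non-leaf beyond
    [c] under [embeds_adjacent_ends]. What remains is an end of degree two at which a path [u], [c],
    [v], [v'] starts. *)
Lemma end_cases u c : (forall t, e u t = (t == c)) -> embeds T G \/
  exists a v v' : T, [/\ leaf_at a u, forall t, adj u t = (t == a) || (t == c),
    e c v /\ v != u, adj v v' & c != v'].
Proof.
move=> eu; have : e u c by rewrite eu.
case/and3P=> uc u1 c1.
have [/existsP[v /andP[ecv vu]]|/existsPn no] := boolP [exists v, e c v && (v != u)]; last first.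
  left; apply: (embeds_adjacent_ends eu) => t ect.
  by apply/eqP; have := no t; rewrite ect /= negbK.
have /and3P[cv _ v1] := ecv.
have other (t s : T) : 1 < degree t -> exists2 r, adj t r & r != s.
  case/card_gt1P=> r1 [r2]; rewrite !inE => -[tr1 tr2 r12].
  have [r1s|] := eqVneq r1 s; last by exists r1.
  by exists r2; rewrite // -r1s eq_sym.
have [v' vv' v'c] := other v c v1.
have cv' : c != v' by rewrite eq_sym.
have lu t : adj u t -> t != c -> leaf_at t u.
  by move=> ut tc; apply: edge_nonleaf; rewrite ?eu.
have [a ua ac] := other u c u1; have la := lu a ua ac.
have [/existsP[b /and3P[ub bc ba]]|/existsPn nb] := boolP [exists b, [&& adj u b, b != c & b != a]].
  left; apply: (embeds_twin_leaves treeT degG xy yz zz' nxz nxz' la (lu b ub bc) _ uc cv vv');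
    by rewrite // eq_sym.
right; exists a, v, v'; split=> // t; apply/idP/orP => [ut|[]/eqP->//].
by have := nb t; rewrite ut /= negb_and !negbK => /orP[->|->]; auto.
Qed.

Lemma embeds_walk : embeds T G.
Proof.
have [p [q epq]] := exists_nonleaf_edge.
have e_sym : symmetric e by move=> s t; rewrite /e adj_sym [X in _ && X]andbC.
have e_irr : irreflexive e by move=> s; rewrite /e adj_irr.
have e_acyc s : 2 < size s -> ~ ucycle e s.
  move=> s2 /andP[cs us]; apply: (treeT.2 s s2); rewrite /ucycle us andbT.
  by apply: sub_cycle cs => i j /andP[].
have [u [c [w [w0 [uw eu ew]]]]] := exists_two_ends e_sym e_irr e_acyc epq.
have [//|[a [v [v' [la Nu [ecv vu] vv' cv']]]]] := end_cases eu.
have [//|[b [r [_ [lb Nw [ew0r rw] _ _]]]]] := end_cases ew.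
have /and3P[uc u1 c1] : e u c by rewrite eu.
have /and3P[ww0 w1 w01] : e w w0 by rewrite ew.
have ab : a != b.
  apply: contraNneq uw => ab; move: (lb u); rewrite -ab la eqxx => /esym/eqP->.
  exact: eqxx.
have inY t : 1 < degree t -> t \in ~: [set a; b].
  move=> t1; rewrite !inE negb_or; apply/andP; split.
    by apply: contraTneq t1 => ->; rewrite (leaf_degree la).
  by apply: contraTneq t1 => ->; rewrite (leaf_degree lb).
have w0b : w0 != b.
  by apply: contraTneq w01 => ->; rewrite (leaf_degree lb).
have wu : w != u by rewrite eq_sym.
have w0u : w0 != u.
  apply: contraNneq rw => w0u; move: ew0r; rewrite w0u eu => /eqP->.
  by rewrite eq_sym -eu -w0u e_sym ew.
(* A non-leaf neighbour [s] of [c] other than both ends continues to a path [u], [c], [s], [s'] that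
   avoids the leaves [a] and [b]. *)
have [/existsP[s /and3P[ecs su sw]]|/existsPn no] := boolP [exists s, [&& e c s, s != u & s != w]].
  have /and3P[cs _ s1] := ecs.
  have /card_gt1P[s1' [s2' []]] := s1; rewrite !inE => ss1 ss2 s12.
  have [s' ss' cs'] : exists2 s', adj s s' & c != s'.
    have [cE|] := eqVneq c s1'; last by exists s1'.
    by exists s2'; rewrite // cE.
  have us : u != s by rewrite eq_sym.
  apply: (embeds_thin_end treeT degG xy yz zz' nxz nxz' la lb ab _ _ uc cs ss' us cs'
     _ _ _ Nw w0b wu w0u); try exact: inY.
  rewrite !inE negb_or; apply/andP; split.
    by apply: contraNneq su => s'a; have := la s; rewrite -s'a adj_sym ss' => /esym.
  by apply: contraNneq sw => s'b; have := lb s; rewrite -s'b adj_sym ss' => /esym.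
(* In the remaining case [T] is a spider with centre [c] whose only long legs are [u], [a] and [w],
   [b]. *)
have ecE t : e c t -> t = u \/ t = w.
  move=> ect; have := no t; rewrite ect /= negb_and !negbK.
  by case/orP=> /eqP; auto.
have ecw : e c w by case: (ecE v ecv) vu => vE; rewrite -?vE // eqxx.
have wc : adj w c by case/and3P: ecw => cw _ _; rewrite adj_sym.
have w0c : w0 = c by apply/esym/eqP; rewrite -ew e_sym.
have all t : t \in [set t | adj c t] :|: [set a; b; c].
  apply: (conn_boundary treeT.1 (x0 := c)); first by rewrite !inE eqxx !orbT.
  move=> p' q'; rewrite !inE -!orbA; case/or4P=> [cp'|/eqP->|/eqP->|/eqP->->//].
  - have [->|p'u] := eqVneq p' u; first by rewrite Nu => /orP[]->; rewrite !orbT.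
    have [->|p'w] := eqVneq p' w; first by rewrite Nw w0c => /orP[]->; rewrite !orbT.
    rewrite (edge_nonleaf cp' c1) => [->|]; first by rewrite !orbT.
    by apply/negP=> /ecE[/eqP|/eqP]; apply/negP.
  - by rewrite la => /eqP->; rewrite adj_sym uc.
  - by rewrite lb => /eqP->; rewrite adj_sym wc.
(* Five vertices have been named, and [T] has at least six. *)
have [t1 t1X] : exists t1, t1 \notin [set a; b; c; u; w].
  apply/existsP; rewrite -negb_forall; apply/negP => /forallP allX.
  have : #|T| <= #|[set a; b; c; u; w]|.
    by rewrite -cardsT; apply/subset_leq_card/subsetP => t _.
  by rewrite -!setUA !cardsU1 cards1; move: cardT; clear; lia.
move: t1X; rewrite !inE !negb_or -!andbA => /and5P[t1a t1b t1c t1u t1w].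
apply: (embeds_spider treeT degG xy yz zz' nxz nxz' la lb ab _ _ uc wc _ uw t1u t1w);
  try exact: inY.
- have := all t1; rewrite !inE (negPf t1a) (negPf t1b) (negPf t1c) !orbF.
  by rewrite adj_sym.
- by rewrite !inE negb_or t1a.
move=> t; rewrite !inE negb_or => /andP[ta tb] tc.
by have := all t; rewrite !inE (negPf ta) (negPf tb) (negPf tc) !orbF.
Qed.

End WalkCase.

(** * The colour classes of a tree *)

(** A connected coloured set grows one vertex at a time; by [acyc_unique] the new vertex has one
    neighbour in the set and takes the opposite colour. *)
Lemma tree_bipartite (T : sgraph) : is_tree T ->
  exists h : T -> bool, forall x y, adj x y -> h x != h y.
Proof.
move=> treeT; have /card_gt0P[x0 _] := treeT.1.1.
pose P k := exists (X : {set T}) (h : T -> bool), [/\ x0 \in X, conn X,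
  #|T| <= #|X| + k & {in X &, forall x y, adj x y -> h x != h y}].
suff [X [h [x0X _ le_X hX]]] : P 0.
  exists h => x y; have allX : X = setT.
    by apply/eqP; rewrite eqEcard subsetT cardsT -[#|X|]addn0.
  by apply: hX; rewrite allX inE.
have: P #|T|.
  exists [set x0], xpredT; split; rewrite ?set11 ?leq_addl //; first exact: conn1.
  by move=> x y; rewrite !inE => /eqP-> /eqP->; rewrite adj_irr.
elim: #|T| => // k IH [X [h [x0X cX le_X hX]]]; apply: IH.
have [/existsP[x /existsP[y /and3P[xX yX xy]]]|/existsPn no] :=
    boolP [exists x, exists y, [&& x \in X, y \notin X & adj x y]]; last first.
  have allX t : t \in X.
    apply: (conn_boundary treeT.1 x0X) => x y xX xy; apply: contraT => yX.
    by have /existsPn/(_ y) := no x; rewrite xX yX xy.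
  exists X, h; split=> //; apply: leq_trans (leq_addr _ _).
  by rewrite -cardsT; apply/subset_leq_card/subsetP.
have yx : adj y x by rewrite adj_sym.
exists (y |: X), (fun t => if t == y then ~~ h x else h t); split.
- by rewrite inE x0X orbT.
- exact: connU1 xX yx.
- by rewrite cardsU1 yX; move: le_X; clear; lia.
have neq t : t \in X -> (t == y) = false by apply: contraTF => /eqP->.
have hyx t : t \in X -> adj y t -> ~~ h x != h t.
  by move=> tX yt; rewrite (acyc_unique treeT.2 cX yX xX yx tX yt); case: (h x).
move=> s t; rewrite !inE => /predU1P[->|sX] /predU1P[->|tX].
- by rewrite adj_irr.
- by rewrite eqxx neq //; apply: hyx.
- by rewrite eqxx neq // adj_sym eq_sym; apply: hyx.
- by rewrite !neq //; apply: hX.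
Qed.

(* Otherwise three vertices on each side would span a 4-cycle or a 6-cycle. *)
Lemma exists_nonadj_pair (T : sgraph) (h : T -> bool) s : acyclic T ->
    3 <= #|[set t | h t == s]| -> 3 <= #|[set t | h t != s]| ->
  exists a b b', [/\ h a == s, h b != s /\ h b' != s, b != b', ~~ adj a b & ~~ adj a b'].
Proof.
move=> acT /card_gt2P[a1 [a2 [a3 [[A1 A2 A3] [a12 a23 a31]]]]].
move=> /card_gt2P[b1 [b2 [b3 [[B1 B2 B3] [b12 b23 b31]]]]].
(* [P t] says that [t] misses two of the three [b]s. If [P] fails for every [a], then each sees two
   of them; two equal pairs give a 4-cycle, three distinct pairs a 6-cycle. *)
pose P t := [|| ~~ adj t b1 && ~~ adj t b2, ~~ adj t b1 && ~~ adj t b3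
  | ~~ adj t b2 && ~~ adj t b3].
rewrite !inE in A1 A2 A3 B1 B2 B3.
have found t : h t == s -> P t -> exists a b b',
    [/\ h a == s, h b != s /\ h b' != s, b != b', ~~ adj a b & ~~ adj a b'].
  move=> ts /or3P[]/andP[n1 n2].
  - by exists t, b1, b2.
  - by exists t, b1, b3; split=> //; rewrite eq_sym.
  - by exists t, b2, b3.
have [/(found _ A1)//|P1] := boolP (P a1).
have [/(found _ A2)//|P2] := boolP (P a2).
have [/(found _ A3)//|P3] := boolP (P a3).
have ab a b : h a == s -> h b != s -> a != b.
  by move=> ha; apply: contraNneq => <-.
have ba a b : h a == s -> h b != s -> b != a.
  by move=> ha hb; rewrite eq_sym ab.
have C4 a a' b b' : h a == s -> h a' == s -> h b != s -> h b' != s ->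
    a != a' -> b != b' -> ~~ [&& adj a b, adj a' b, adj a' b' & adj a b'].
  move=> ha ha' hb hb' aa' bb'; apply/negP => /and4P[e1 e2 e3 e4].
  apply: (acT [:: a; b; a'; b']) => //; apply/andP; split.
    by rewrite /= e1 (adj_sym b) e2 e3 adj_sym e4.
  by rewrite /= !inE !negb_or aa' bb' (ab a b) // (ab a b') // (ba a' b) //
    (ab a' b').
have C6 b b' b'' : h b != s -> h b' != s -> h b'' != s ->
    b != b' -> b' != b'' -> b'' != b ->
    ~~ [&& adj a1 b, adj a2 b, adj a2 b', adj a3 b', adj a3 b'' & adj a1 b''].
  move=> hb hb' hb'' bb' bb'' bbb; apply/negP => /and5P[e1 e2 e3 e4 /andP[e5 e6]].
  apply: (acT [:: a1; b; a2; b'; a3; b'']) => //; apply/andP; split.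
    by rewrite /= e1 (adj_sym b) e2 e3 (adj_sym b') e4 e5 adj_sym e6.
  rewrite /= !inE !negb_or a12 (eq_sym a1 a3) a31 a23 bb' bb'' (eq_sym b b'') bbb.
  by rewrite (ab a1) // (ab a1) // (ab a1) // (ab a2) // (ab a2) // (ab a3) //
    !ba.
have b21 : b2 != b1 by rewrite eq_sym.
have b32 : b3 != b2 by rewrite eq_sym.
have b13 : b1 != b3 by rewrite eq_sym.
have a13 : a1 != a3 by rewrite eq_sym.
move: P1 P2 P3.
have := C6 b1 b2 b3 B1 B2 B3 b12 b23 b31.
have := C6 b2 b3 b1 B2 B3 B1 b23 b31 b12.
have := C6 b3 b1 b2 B3 B1 B2 b31 b12 b23.
have := C6 b1 b3 b2 B1 B3 B2 b13 b32 b21.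
have := C6 b2 b1 b3 B2 B1 B3 b21 b13 b32.
have := C6 b3 b2 b1 B3 B2 B1 b32 b21 b13.
have := C4 a1 a2 b1 b2 A1 A2 B1 B2 a12 b12.
have := C4 a1 a2 b2 b3 A1 A2 B2 B3 a12 b23.
have := C4 a1 a2 b3 b1 A1 A2 B3 B1 a12 b31.
have := C4 a1 a3 b1 b2 A1 A3 B1 B2 a13 b12.
have := C4 a1 a3 b2 b3 A1 A3 B2 B3 a13 b23.
have := C4 a1 a3 b3 b1 A1 A3 B3 B1 a13 b31.
have := C4 a2 a3 b1 b2 A2 A3 B1 B2 a23 b12.
have := C4 a2 a3 b2 b3 A2 A3 B2 B3 a23 b23.
have := C4 a2 a3 b3 b1 A2 A3 B3 B1 a23 b31.
(* What is left is propositional in the nine adjacencies. *)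
rewrite /P; clear.
case: (adj a1 b1) (adj a1 b2) (adj a1 b3) => [] [] [] //=;
case: (adj a2 b1) (adj a2 b2) (adj a2 b3) => [] [] [] //=;
by case: (adj a3 b1) (adj a3 b2) (adj a3 b3) => [] [] [].
Qed.

(** * Embedding into a complete multipartite graph *)

Section Multipartite.

Variables T G : sgraph.
Hypothesis acT : acyclic T.
Hypothesis degG : forall v : G, #|T| <= degree v + 3.
Hypothesis cardG : #|T| <= #|G|.
(* [G] is complete multipartite. *)
Hypothesis nadj_trans : forall u v w : G, ~~ adj u v -> ~~ adj v w -> ~~ adj u w.
Variable h : T -> bool.
Hypothesis hP : forall s t, adj s t -> h s != h t.
Let A := [set t | h t].
Let B := [set t | ~~ h t].
Hypotheses (A3 : 3 <= #|A|) (B3 : 3 <= #|B|).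

(** The three sets are completely joined to one another and each receives an independent set of [T],
    so only the sizes matter. *)
Lemma embeds_parts (S C D : {set G}) (I : {set T}) :
    (forall u v, u \in S -> v \in C -> adj u v) ->
    (forall u v, u \in S -> v \in D -> adj u v) ->
    (forall u v, u \in C -> v \in D -> adj u v) ->
    {in I &, forall s t, ~~ adj s t} ->
    #|A :\: I| <= #|S| -> #|I| <= #|C| -> #|B :\: I| <= #|D| ->
  embeds T G.
Proof.
move=> SC SD CD indI leS leC leD.
have dis (X Y : {set G}) : (forall u v, u \in X -> v \in Y -> adj u v) ->
    forall v, v \in Y -> v \notin X.
  move=> XY v vY; apply/negP => vX; have := XY v v vX vY; by rewrite adj_irr.
(* The outer [None] marks the vertices of [G] outside the three sets, the inner one the vertices of
   [I] and [C]. *)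
pose l t : option (option bool) := Some (if t \in I then None else Some (h t)).
pose k v : option (option bool) := if v \in S then Some (Some true)
  else if v \in C then Some None else if v \in D then Some (Some false) else None.
have kS v : v \in S -> k v = Some (Some true) by rewrite /k => ->.
have kC v : v \in C -> k v = Some None.
  by move=> vC; rewrite /k (negPf (dis _ _ SC v vC)) vC.
have kD v : v \in D -> k v = Some (Some false).
  by move=> vD; rewrite /k (negPf (dis _ _ SD v vD)) (negPf (dis _ _ CD v vD)) vD.
have le_class (X : {set T}) (Y : {set G}) i : (forall t, l t = i -> t \in X) ->
    (forall v, v \in Y -> k v = i) -> #|X| <= #|Y| ->
    #|[set t | l t == i]| <= #|[set v | k v == i]|.
  move=> lX kY leXY; apply: leq_trans (subset_leq_card _) (leq_trans leXY (subset_leq_card _)).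
    by apply/subsetP => t; rewrite inE => /eqP/lX.
  by apply/subsetP => v vY; rewrite inE kY.
have [|f [inj_f kf]] := @lift_classes T G _ l k.
  move=> [[[]|]|].
  - by apply: (le_class _ _ _ _ kS leS) => t [] ; rewrite !inE; case: ifP => // _ [->].
  - by apply: (le_class _ _ _ _ kD leD) => t [] ; rewrite !inE; case: ifP => // _ [->].
  - by apply: (le_class _ _ _ _ kC leC) => t []; case: ifP.
  - by rewrite eq_card0 // => t; rewrite !inE.
have kinv v : [/\ k v = Some (Some true) -> v \in S, k v = Some None -> v \in C
    & k v = Some (Some false) -> v \in D].
  by rewrite /k; case: (v \in S) (v \in C) (v \in D) => [] [] [].
exists f; split=> // s t st; have := hP st; move: (kf s) (kf t); rewrite /l.
have [sS sC sD] := kinv (f s); have [tS tC tD] := kinv (f t).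
case: (boolP (s \in I)) (boolP (t \in I)) => sI [] tI.
- by have := indI _ _ sI tI; rewrite st.
- by case: (h t) => /sC fs; [move/tS|move/tD] => ft _; [rewrite adj_sym SC|rewrite CD].
- by case: (h s) => [/sS|/sD] fs /tC ft _; [rewrite SC|rewrite adj_sym CD].
case: (h s) (h t) => [] [] // => [/sS fs /tD ft _|/sD fs /tS ft _]; first by rewrite SD.
by rewrite adj_sym SD.
Qed.

(* [S] is a union of parts, of maximal size below [#|A|]; the two sides of [T]
   go to [S] and to the complement of the next part [C], and the at most three
   vertices that do not fit are put into [C]. *)
Lemma embeds_multipartite : embeds T G.
Proof.
pose closed (S : {set G}) := [forall u in S, forall v, ~~ adj u v ==> (v \in S)] && (#|S| < #|A|).
have closed0 : closed set0.
  rewrite /closed cards0 (leq_trans _ A3) // andbT.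
  by apply/forallP => u; rewrite inE.
case: (@arg_maxnP _ set0 closed (fun S : {set G} => #|S|) closed0) => S /andP[cS SA] maxS.
have {}cS u v : u \in S -> ~~ adj u v -> v \in S.
  by move=> uS; have /forallP/(_ u)/implyP/(_ uS)/forallP/(_ v)/implyP := cS.
have cAB : #|A| + #|B| = #|T|.
  by rewrite -(cardsC A); congr (_ + _); apply: eq_card => t; rewrite !inE.
have [v vS] : exists v, v \notin S.
  apply/existsP; rewrite -negb_forall; apply/negP => /forallP allS.
  have : #|G| <= #|S| by rewrite -cardsT; apply/subset_leq_card/subsetP => u _.
  by move: SA cAB cardG; clear; lia.
pose C := [set w | ~~ adj v w]; pose D := ~: (S :|: C).
have SC u w : u \in S -> w \in C -> adj u w.
  rewrite inE => uS vw; apply: contraR vS => nuw.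
  by apply: (cS u) => //; apply: (nadj_trans nuw); rewrite adj_sym.
have SD u w : u \in S -> w \in D -> adj u w.
  by rewrite !inE negb_or => uS /andP[wS _]; apply: contraR wS; apply: cS.
have CD u w : u \in C -> w \in D -> adj u w.
  rewrite !inE negb_or negbK => vu /andP[_ vw]; apply: contraLR vw.
  by apply: nadj_trans.
have vC : v \in C by rewrite inE adj_irr.
have dSC : S :&: C = set0.
  apply/setP => u; rewrite !inE; apply/negP => /andP[uS uC].
  by have := SC u u uS; rewrite inE uC adj_irr => /(_ isT).
have cSC : #|S :|: C| = #|S| + #|C| by rewrite cardsU dSC cards0 subn0.
have cD : #|S| + #|C| + #|D| = #|G| by rewrite -cSC cardsC.
have cC : #|C| + degree v = #|G|.
  by rewrite -(cardsC C); congr (_ + _); apply: eq_card => u; rewrite !inE negbK.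
(* Otherwise [S :|: C] would contradict the maximality of [S]. *)
have leA : #|A| <= #|S| + #|C|.
  rewrite leqNgt -cSC; apply/negP => lt.
  have /maxS : closed (S :|: C).
    rewrite /closed lt andbT; apply/forallP => u; apply/implyP => uSC.
    apply/forallP => w; apply/implyP => nuw; move: uSC; rewrite !inE.
    case/orP=> [uS|vu]; first by rewrite (cS u).
    by rewrite (nadj_trans vu nuw) orbT.
  have : 0 < #|C| by apply/card_gt0P; exists v.
  by rewrite cSC; clear; lia.
have indep (I : {set T}) : I \subset A \/ I \subset B -> {in I &, forall s t, ~~ adj s t}.
  move=> IAB s t sI tI; apply/negP => /hP.
  by case: IAB => IX; have := subsetP IX s sI; have := subsetP IX t tI;
     rewrite !inE; case: (h s) (h t) => [] [].
(* If [B] fits into [D], only the overflow of [A] goes to [C]. *)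
have [leB|ltB] := leqP #|B| #|D|.
  have [|I IA cI] := @exists_subset_card _ A (#|A| - #|S|); first exact: leq_subr.
  apply: (embeds_parts SC SD CD (indep I (or_introl IA))).
  - by rewrite cardsDS // cI; move: SA; clear; lia.
  - by rewrite cI; move: leA; clear; lia.
  by apply: leq_trans (subset_leq_card (subsetDl _ _)) leB.
(* [S] and [D] together have as many vertices as [v] has neighbours, at least [#|T| - 3]. *)
have small : #|A| - #|S| + (#|B| - #|D|) <= 3.
  by have := degG v; move: SA ltB cAB cD cC; clear; lia.
have leC : #|A| - #|S| + (#|B| - #|D|) <= #|C|.
  by move: SA ltB cAB cD cardG; clear; lia.
(* [X] is the side of [T] that loses one vertex to [C]. *)
have split1 (X Y J : {set T}) a : (X = A /\ Y = B \/ X = B /\ Y = A) ->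
    a \in X -> J \subset Y -> (forall b, b \in J -> ~~ adj a b) ->
    [/\ #|X :\: (a |: J)| = #|X|.-1, #|a |: J| = #|J|.+1,
      #|Y :\: (a |: J)| = #|Y| - #|J| & {in a |: J &, forall s t, ~~ adj s t}].
  move=> XY aX JY aJ.
  have dXY t : t \in X -> t \notin Y.
    by case: XY => -[-> ->]; rewrite !inE ?negbK.
  have aJ' : a \notin J by apply: contra (dXY a aX); apply: subsetP.
  split; last 1 first.
  - have indJ := indep J; move=> s t.
    rewrite !inE => /predU1P[->|sJ] /predU1P[->|tJ]; rewrite ?adj_irr ?aJ //.
      by rewrite adj_sym aJ.
    by apply: indJ => //; case: XY => -[_ YE]; rewrite YE in JY; auto.
  - rewrite (cardsD1 a X) aX /=; apply: eq_card => t; rewrite !inE negb_or.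
    by case: (t \in X) / boolP => tX; rewrite ?andbF // (contra (subsetP JY t)) ?dXY // andbT.
  - by rewrite cardsU1 aJ'.
  rewrite -(cardsDS JY); apply: eq_card => t; rewrite !inE negb_or.
  by have [->|] //= := eqVneq t a; rewrite (negPf (dXY a aX)) andbF.
have AE : A = [set t | h t == true] by apply/setP=> t; rewrite !inE eqb_id.
have BE : B = [set t | h t != true] by apply/setP=> t; rewrite !inE eqb_id.
have [||a [b [b' [ha [hb hb'] bb' nab nab']]]] := exists_nonadj_pair (h := h) (s := true) acT.
- by rewrite -AE.
- by rewrite -BE.
have [||c [d [d' [hc [hd hd'] dd' ncd ncd']]]] := exists_nonadj_pair (h := h) (s := false) acT.
- by rewrite (_ : [set t | _] = B) //; apply/setP => t; rewrite !inE eqbF_neg.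
- by rewrite (_ : [set t | _] = A) //; apply/setP => t; rewrite !inE eqbF_neg negbK.
rewrite eqb_id in ha; rewrite !eqb_id in hb hb'.
rewrite eqbF_neg in hc; rewrite !eqbF_neg !negbK in hd hd'.
(* Both overflows are positive with sum at most three, so they are 1 and 1, 1 and 2, or 2 and 1. *)
have [i1|i2] := leqP (#|A| - #|S|) 1.
  have [||||cA cI cB ind] := split1 A B [set b; b'] a.
  - by left.
  - by rewrite inE.
  - by rewrite subUset !sub1set !inE hb.
  - by move=> t; rewrite !inE => /orP[]/eqP->.
  rewrite cards2 bb' in cI cB.
  have [j1|j2] := leqP (#|B| - #|D|) 1.
    (* When both overflows are 1, [C] may have just two vertices, so [b'] stays out of it. *)
    have [||||cA' cI' cB' ind'] := split1 A B [set b] a.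
    - by left.
    - by rewrite inE.
    - by rewrite sub1set inE.
    - by move=> t; rewrite inE => /eqP->.
    rewrite cards1 in cI' cB'; apply: (embeds_parts SC SD CD ind').
    - by rewrite cA'; move: i1; clear; lia.
    - by rewrite cI'; move: SA ltB leC; clear; lia.
    - by rewrite cB'; move: j1; clear; lia.
  apply: (embeds_parts SC SD CD ind).
  - by rewrite cA; move: i1; clear; lia.
  - by rewrite cI; move: SA j2 leC; clear; lia.
  - by rewrite cB; move: SA small; clear; lia.
have [||||cB cI cA ind] := split1 B A [set d; d'] c.
- by right.
- by rewrite inE.
- by rewrite subUset !sub1set !inE hd.
- by move=> t; rewrite !inE => /orP[]/eqP->.
rewrite cards2 dd' in cI cA; apply: (embeds_parts SC SD CD ind).
- by rewrite cA; move: ltB small; clear; lia.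
- by rewrite cI; move: ltB i2 leC; clear; lia.
- by rewrite cB; move: i2 small; clear; lia.
Qed.

End Multipartite.

(** * Each colour class has at least three vertices *)

Section SmallSide.

Variable T : sgraph.
Hypothesis treeT : is_tree T.
Hypothesis degT : forall t : T, degree t + 3 <= #|T|.
Variable h : T -> bool.
Hypothesis hP : forall s t, adj s t -> h s != h t.
Let A := [set t | h t].

Lemma exists_neighbour (t : T) : exists s, adj t s.
Proof.
have [/existsP//|/existsPn no] := boolP [exists s, adj t s].
have all s : s \in [set t].
  apply: (conn_boundary treeT.1 (x0 := t)); first by rewrite inE.
  by move=> p q; rewrite inE => /eqP->; rewrite (negPf (no q)).
have : #|T| <= #|[set t]| by rewrite -cardsT; apply/subset_leq_card/subsetP.
by rewrite cards1; have := degT t; clear; lia.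
Qed.

Lemma neighbour_side (s t : T) : h s = false -> adj s t -> t \in A.
Proof. by rewrite inE => hs /hP; rewrite hs; case: (h t). Qed.

(** With a single vertex in the class, [T] would be a star, against [degT]. *)
Lemma side_gt1 : 1 < #|A|.
Proof.
rewrite ltnNge; apply/negP => A1.
have [v vA] : exists v, v \in A.
  have /card_gt0P[t _] := treeT.1.1; have [ht|ht] := boolP (h t); first by exists t; rewrite inE.
  have [s ts] := exists_neighbour t; exists s.
  by apply: neighbour_side ts; apply: negPf.
have all t : t \in v |: [set t | adj v t].
  rewrite !inE; have [//|tv] := eqVneq t v; have [s ts] := exists_neighbour t.
  have ht : h t = false.
    by apply: contraNF tv => ht; apply/eqP/(card_le1_eqP A1); rewrite // inE.
  have sA := neighbour_side ht ts.
  by rewrite (_ : v = s) 1?adj_sym ?ts ?orbT //; apply: (card_le1_eqP A1).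
have : #|T| <= #|v |: [set t | adj v t]| by rewrite -cardsT; apply/subset_leq_card/subsetP.
by rewrite cardsU1 !inE adj_irr -/(degree v); have := degT v; clear; lia.
Qed.

Hypothesis notTpq : forall p : nat, 0 < p -> 0 < #|T| - 3 - p ->
  ~ isomorphic T (Tpq p (#|T| - 3 - p)).

(** Two vertices forming a class have a common neighbour by connectedness and no second one by
    acyclicity. All other vertices are leaves at one of the two, which makes [T] a T(p,q). *)
Lemma side_gt2 : 2 < #|A|.
Proof.
have [//|A2] := ltnP 2 #|A|; exfalso.
have /cards2P[v1 [v2 [v12 AE]]] : #|A| == 2 by rewrite eqn_leq A2 side_gt1.
have hA t : h t = (t == v1) || (t == v2).
  by have := in_set h t; rewrite -[[set x | h x]]/A AE !inE.
have nadjA s t : h s -> h t -> adj s t = false.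
  by move=> hs ht; apply/negP => /hP; rewrite hs ht.
have nadjB s t : h s = false -> h t = false -> adj s t = false.
  by move=> hs ht; apply/negP => /hP; rewrite hs ht.
have h1 : h v1 by rewrite hA eqxx.
have h2 : h v2 by rewrite hA eqxx orbT.
have [c c1 c2] : exists2 c, adj v1 c & adj v2 c.
  have [/existsP[c /andP[*]]|/existsPn no] := boolP [exists c, adj v1 c && adj v2 c].
    by exists c.
  have : v2 \in v1 |: [set t | adj v1 t].
    apply: (conn_boundary treeT.1 (x0 := v1)); first by rewrite !inE eqxx.
    move=> p q; rewrite !inE => /predU1P[->->|vp]; first by rewrite orbT.
    move=> pq; have hp : h p = false.
      by apply/negP => hp; rewrite (nadjA v1 p h1 hp) in vp.
    have := neighbour_side hp pq; rewrite inE hA => /orP[->//|/eqP q2].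
    by have := no p; rewrite vp -q2 adj_sym pq.
  by rewrite !inE eq_sym (negPf v12) nadjA.
have hc : h c = false by apply/negP => hc; rewrite (nadjA v1 c h1 hc) in c1.
have uniq_c t : adj v1 t -> adj v2 t -> t = c.
  move=> t1 t2; apply/eqP; apply: contraT => tc.
  have ht : h t = false by apply/negP => ht; rewrite (nadjA v1 t h1 ht) in t1.
  case: (treeT.2 [:: v1; t; v2; c]) => //; apply/andP; split.
    by rewrite /= t1 adj_sym t2 c2 adj_sym c1.
  rewrite /= !inE !negb_or v12 tc andbT /=.
  by rewrite ![_ == t]eq_sym ![_ == c]eq_sym; move: ht hc;
     rewrite !hA => /norP[-> ->] /norP[-> ->].
have adjB t : h t = false -> t != c -> adj v2 t = ~~ adj v1 t.
  move=> ht tc; have [s ts] := exists_neighbour t.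
  have := neighbour_side ht ts; rewrite inE hA.
  have [t1|nt1] := boolP (adj v1 t).
    by move=> _; apply: contraNF tc => t2; rewrite (uniq_c t).
  by case/orP=> /eqP sE; move: ts; rewrite sE adj_sym // (negPf nt1).
pose P := [set t | adj v1 t] :\ c; pose Q := [set t | adj v2 t] :\ c.
have cP : degree v1 = #|P|.+1 by rewrite /degree (cardsD1 c) inE c1.
have cQ : degree v2 = #|Q|.+1 by rewrite /degree (cardsD1 c) inE c2.
have cT : #|T| = 3 + (#|P| + #|Q|).
  have dPQ : P :&: Q = set0.
    apply/setP=> t; rewrite !inE; apply/negP => /andP[/andP[tc t1] /andP[_ t2]].
    by rewrite (uniq_c t t1 t2) eqxx in tc.
  have cB : #|~: A| = #|c |: (P :|: Q)|.
    apply: eq_card => t; rewrite !inE; have [->|tc] := eqVneq t c; first by rewrite hc.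
    have [ht|ht] := boolP (h t); last by rewrite adjB ?orbN //; apply: negPf.
    by rewrite !nadjA.
  rewrite -(cardsC A) cB cardsU1 cardsU dPQ cards0 subn0 AE cards2 v12.
  by rewrite !inE eqxx.
have Tpq : isomorphic T (Tpq #|P| #|Q|); last first.
  (* The degree bound at [v2] makes [P] nonempty, and the one at [v1] makes [Q] nonempty. *)
  apply: (notTpq (p := #|P|)).
  - by have := degT v2; rewrite cQ cT; clear; lia.
  - by have := degT v1; rewrite cP cT; clear; lia.
  by rewrite (_ : #|T| - 3 - #|P| = #|Q|) // cT addKn addKn.
(* [K] is T(p,q) with the leaves at each end identified, [true] standing for those at [v1]; [arc] is
   its oriented adjacency. The isomorphism comes from matching the labels in [K]. *)
pose K := ('I_3 + bool)%type.
pose arc (i j : K) := match i, j with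
  | inl i, inl j => j == i.+1 :> nat
  | inl i, inr b => i == (if b then 0 else 2) :> nat
  | _, _ => false end.
pose l t : K := if t == v1 then inl ord0 else if t == c then inl (inord 1)
  else if t == v2 then inl (inord 2) else inr (adj v1 t).
pose k (x : Tpq #|P| #|Q|) : K := match x with
  | inl i => inl i | inr (inl _) => inr true | inr (inr _) => inr false end.
have cv1 : (c == v1) = false by apply/negP => /eqP cv; rewrite cv h1 in hc.
have cv2 : (c == v2) = false by apply/negP => /eqP cv; rewrite cv h2 in hc.
have v21 : (v2 == v1) = false by rewrite eq_sym (negPf v12).
have l1 : l v1 = inl ord0 by rewrite /l eqxx.
have lc : l c = inl (inord 1) by rewrite /l cv1 eqxx.
have l2 : l v2 = inl (inord 2) by rewrite /l v21 eq_sym cv2 eqxx.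
have lB t : h t = false -> t != c -> l t = inr (adj v1 t).
  by rewrite hA /l => /norP[/negPf-> /negPf->] /negPf->.
have [|f [inj_f kf]] := @lift_classes T (Tpq #|P| #|Q|) _ l k.
  have le1 (i : 'I_3) v : (forall t, l t = inl i -> t = v) ->
      #|[set t | l t == inl i]| <= #|[set x | k x == inl i]|.
    move=> lv; apply: (@leq_trans 1).
      rewrite -[X in _ <= X](cards1 v); apply/subset_leq_card/subsetP => t.
      by rewrite !inE => /eqP/lv->.
    by apply/card_gt0P; exists (inl i); rewrite inE /= eqxx.
  have l_inv t : [/\ l t = inl ord0 -> t = v1, l t = inl (inord 1) -> t = c,
      l t = inl (inord 2) -> t = v2, l t = inr true -> t \in P & l t = inr false -> t \in Q].
    rewrite !inE /l; have [->|t1] := eqVneq t v1.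
      by split=> // -[] /(congr1 val); rewrite /= inordK.
    have [->|tc] := eqVneq t c.
      by split=> // -[] /(congr1 val); rewrite /= ?inordK.
    have [->|t2] := eqVneq t v2.
      by split=> // -[] /(congr1 val); rewrite /= ?inordK.
    split=> // -[]; first by [].
    by move=> nt1; rewrite adjB ?nt1 // hA (negPf t1) (negPf t2).
  case=> [i|[]].
  - case: (ltnP i 1) => i1.
      by apply: (le1 _ v1) => t; rewrite (_ : i = ord0);
         [have [] := l_inv t|apply/val_inj => /=; case: (val i) i1].
    have [i2|i2] := leqP i 1.
      apply: (le1 _ c) => t; rewrite (_ : i = inord 1); first by have [] := l_inv t.
      by apply/val_inj; rewrite /= inordK //; apply/eqP; rewrite eqn_leq i2.
    apply: (le1 _ v2) => t; rewrite (_ : i = inord 2); first by have [] := l_inv t.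
    by apply/val_inj; rewrite /= inordK //; apply/eqP; rewrite eqn_leq i2 andbT -ltnS.
  - apply: (@leq_trans #|P|).
      by apply/subset_leq_card/subsetP => t; rewrite inE => /eqP; have [] := l_inv t.
    have inj_g : injective (fun i : 'I_#|P| => inr (inl i) : Tpq #|P| #|Q|) by move=> i j [].
    rewrite -[X in X <= _]card_ord -cardsT -(card_imset _ inj_g).
    by apply/subset_leq_card/subsetP => x /imsetP[i _ ->]; rewrite inE.
  - apply: (@leq_trans #|Q|).
      by apply/subset_leq_card/subsetP => t; rewrite inE => /eqP; have [] := l_inv t.
    have inj_g : injective (fun i : 'I_#|Q| => inr (inr i) : Tpq #|P| #|Q|) by move=> i j [].
    rewrite -[X in X <= _]card_ord -cardsT -(card_imset _ inj_g).
    by apply/subset_leq_card/subsetP => x /imsetP[i _ ->]; rewrite inE.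
exists f; split.
  by apply: inj_card_bij => //; rewrite cT /= !card_sum !card_ord.
pose M i j := arc i j || arc j i.
have MC i j : M i j = M j i by rewrite /M orbC.
have adjK x y : adj x y = M (k x) (k y).
  by case: x y => [i|[i|i]] [j|[j|j]].
move=> s t; rewrite adjK !kf.
have main u v : h u -> h v = false -> M (l u) (l v) = adj u v.
  rewrite (hA u) => u12 hv; have [->|vc] := eqVneq v c.
    by case/orP: u12 => /eqP->; rewrite lc ?l1 ?l2 /M /arc !inordK //= ?c1 ?c2.
  rewrite (lB v hv vc); case/orP: u12 => /eqP->; rewrite ?l1 ?l2 /M /arc ?inordK // orbF.
    by case: (adj v1 v).
  by rewrite adjB //; case: (adj v1 v).
have [hs|/negPf hs] := boolP (h s); have [ht|/negPf ht] := boolP (h t).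
- rewrite nadjA //; move: hs ht; rewrite !hA.
  by move=> /orP[]/eqP-> /orP[]/eqP->; rewrite ?l1 ?l2 /M /arc ?inordK.
- exact: main.
- by rewrite MC adj_sym main.
rewrite nadjB //; have [->|sc] := eqVneq s c; have [->|tc] := eqVneq t c.
- by rewrite lc /M /arc inordK.
- by rewrite lc (lB t ht tc) /M /arc inordK //; case: (adj v1 t).
- by rewrite lc (lB s hs sc) /M /arc inordK //; case: (adj v1 s).
by rewrite (lB t ht tc) (lB s hs sc).
Qed.

End SmallSide.

(** * Connected graphs with enough vertices *)

(** Without such a walk no edge leaves the ball of radius two around [x], so it is the whole graph.
    Then [u] has a common neighbour [y] with [x], and [x], [y], [u], [w] is such a walk. *)
Lemma exists_walk (G : sgraph) (x u w : G) : connected G ->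
    ~~ adj x u -> ~~ adj x w -> adj u w ->
  exists y z z', [/\ adj x y, adj y z, adj z z', ~~ adj x z & ~~ adj x z'].
Proof.
move=> cG nxu nxw uw.
pose W y z z' := [&& adj x y, adj y z, adj z z', ~~ adj x z & ~~ adj x z'].
have [/existsP[y /existsP[z /existsP[z' /and5P[*]]]]|/existsPn no] :=
    boolP [exists y, exists z, exists z', W y z z']; first by exists y, z, z'.
have {}no y z z' : ~~ W y z z'.
  by have /existsPn/(_ z)/existsPn/(_ z') := no y.
have all v : v \in [set t | [|| t == x, adj x t | [exists y, adj x y && adj y t]]].
  apply: (conn_boundary cG (x0 := x)); first by rewrite !inE eqxx.
  move=> p q; rewrite !inE => /or3P[/eqP->->|xp pq|/existsP[y /andP[xy yp]] pq].
  - by rewrite orbT.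
  - by apply/or3P/Or33/existsP; exists p; rewrite xp.
  have [xp|nxp] := boolP (adj x p).
    by apply/or3P/Or33/existsP; exists p; rewrite xp.
  by have := no y p q; rewrite /W xy yp pq nxp /= negbK => ->; rewrite orbT.
have ux : u != x by apply: contraNneq nxw => <-.
have := all u; rewrite inE (negPf ux) (negPf nxu) /= => /existsP[y /andP[xy yu]].
by have := no y u w; rewrite /W xy yu uw nxu nxw.
Qed.

(** A vertex that misses both ends of an edge starts the walk needed by [embeds_walk]; if there is
    none, non-adjacency is transitive. *)
Theorem embeds_connected (T G : sgraph) : is_tree T ->
    (forall t : T, degree t + 3 <= #|T|) ->
    (forall p : nat, 0 < p -> 0 < #|T| - 3 - p ->
      ~ isomorphic T (Tpq p (#|T| - 3 - p))) ->
    connected G -> #|T| <= #|G| -> (forall v : G, #|T| <= degree v + 3) ->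
  embeds T G.
Proof.
move=> treeT degT notTpq cG leTG degG.
have [h hP] := tree_bipartite treeT.
have A3 := side_gt2 treeT degT hP notTpq.
have B3 : 2 < #|[set t | ~~ h t]|.
  apply: (side_gt2 treeT degT _ notTpq) => s t /hP.
  by case: (h s) (h t) => [] [].
have [/existsP[x /existsP[u /existsP[w /and3P[nxu nxw uw]]]]|/existsPn no] := boolP
    [exists x : G, exists u, exists w, [&& ~~ adj x u, ~~ adj x w & adj u w]].
  have [y [z [z' [xy yz zz' nxz nxz']]]] := exists_walk cG nxu nxw uw.
  apply: (embeds_walk treeT _ degT degG xy yz zz' nxz nxz').
  (* Two classes of at least three vertices give the bound 6. *)
  rewrite -(cardsC [set t | h t]) (_ : ~: _ = [set t | ~~ h t]).
    exact: leq_add A3 B3.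
  by apply/setP=> t; rewrite !inE.
apply: (embeds_multipartite treeT.2 degG leTG _ hP A3 B3) => u v w nuv nvw.
have /existsPn/(_ u)/existsPn/(_ w) := no v.
by rewrite adj_sym nuv nvw.
Qed.

(** * Connected components and their orders *)

Section Component.

Variables (G : sgraph) (r : G).

Definition component_vertex := {x : G | connect adj r x}.

Definition component_adj : rel component_vertex := fun x y => adj (val x) (val y).

Lemma component_adj_sym : symmetric component_adj.
Proof. by move=> x y; apply: adj_sym. Qed.

Lemma component_adj_irr : irreflexive component_adj.
Proof. by move=> x; apply: adj_irr. Qed.

Definition component : sgraph := SGraph component_adj_sym component_adj_irr.

Lemma card_component : #|component| = #|[set x | connect adj r x]|.
Proof. by rewrite cardsE card_sig. Qed.

Lemma component_degree (x : component) : degree x = degree (val x).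
Proof.
rewrite /degree -(card_imset _ val_inj); apply: eq_card => y; rewrite !inE.
apply/imsetP/idP => [[z] + ->|xy]; first by rewrite inE.
have ry : connect adj r y := connect_trans (valP x) (connect1 xy).
by exists (Sub y ry : component); rewrite ?inE ?SubK.
Qed.

Lemma component_connected : connected component.
Proof.
split; first by apply/card_gt0P; exists (Sub r (connect0 _ _) : component).
move=> x y; have : connect adj (val x) (val y).
  apply: connect_trans (valP y).
  by rewrite (sym_connect_sym (@adj_sym G)) (valP x).
case/connectP=> p; elim: p x => [|z p IH] x /= => [_ /val_inj->|/andP[xz pz] ly].
  exact: connect0.
have rz : connect adj r z := connect_trans (valP x) (connect1 xz).
apply: connect_trans (IH (Sub z rz : component) _ _); rewrite ?SubK //.
by apply: connect1; rewrite /= /component_adj SubK.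
Qed.

End Component.

(** A component has more vertices than the degree of any of its vertices, hence at least [d - 2],
    and by assumption fewer than [d]. The coefficients count the components of each size. *)
Lemma component_card_lincomb (G : sgraph) d : (forall v : G, d <= degree v + 3) ->
    (forall r : G, #|component r| < d) ->
  linear_combination [:: d - 1; d - 2] #|G|.
Proof.
move=> degG small.
have eqv : {in [set: G] & &, equivalence_rel (connect adj)}.
  suff eqv : equivalence_rel (connect (@adj G)) by move=> x y z _ _ _; apply: eqv.
  apply/equivalence_relP; split; first exact: connect0.
  move=> x y xy z; apply/idP/idP; apply: connect_trans => //.
  by rewrite (sym_connect_sym (@adj_sym G)).
pose P := equivalence_partition (connect adj) [set: G].
have cardC C : C \in P -> #|C| = if #|C| == d - 1 then d - 1 else d - 2.
  case/imsetP=> r _ ->.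
  have -> : [set y in [set: G] | connect adj r y] = [set y | connect adj r y].
    by apply/setP=> y; rewrite !inE.
  rewrite -card_component; case: eqP => // ne.
  have : degree r < #|component r|.
    rewrite (_ : degree r = degree (Sub r (connect0 _ _) : component r)).
      apply: proper_card; apply/properP; split; first exact/subsetP.
      by exists (Sub r (connect0 _ _) : component r); rewrite // inE adj_irr.
    by rewrite component_degree SubK.
  by have := degG r; have := small r; move: ne; clear; lia.
exists (fun i => if i is 0 then #|[set C in P | #|C| == d - 1]|
  else #|[set C in P | #|C| != d - 1]|).
rewrite !big_ord_recl big_ord0 /= addn0 -cardsT.
rewrite (card_partition (equivalence_partitionP eqv)) (eq_bigr _ cardC) -/P.
rewrite (bigID (fun C : {set G} => #|C| == d - 1)) /=.
congr (_ + _).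
  rewrite (eq_bigr (fun=> d - 1)) => [|C /andP[_ ->]//].
  by rewrite sum_nat_const; congr (_ * _); apply: eq_card => C; rewrite !inE.
rewrite (eq_bigr (fun=> d - 2)) => [|C /andP[_ /negPf->]//].
by rewrite sum_nat_const; congr (_ * _); apply: eq_card => C; rewrite !inE.
Qed.

(** * The red graph of a colouring *)

Section Colouring.

Variables (N : nat) (c : colouring N).

(** A colouring also has values on singletons; [x != y] discards them. *)
Definition red_adj : rel 'I_N := fun x y => (x != y) && c [set x; y].

Lemma red_adj_sym : symmetric red_adj.
Proof. by move=> x y; rewrite /red_adj eq_sym setUC. Qed.

Lemma red_adj_irr : irreflexive red_adj.
Proof. by move=> x; rewrite /red_adj eqxx. Qed.

Definition red : sgraph := SGraph red_adj_sym red_adj_irr.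

Lemma mono_copy_component (T : sgraph) (r : red) :
  embeds T (component r) -> mono_copy c true T.
Proof.
case=> f [inj_f adj_f]; apply/existsP; exists [ffun t => val (f t) : 'I_N].
apply/andP; split.
  by apply/injectiveP => s t; rewrite !ffunE => /val_inj/inj_f.
apply/forallP => s; apply/forallP => t; apply/implyP => /adj_f.
by rewrite !ffunE eqb_id => /andP[].
Qed.

(** Of the [N - 1] other vertices, those not joined to [v] by red are blue neighbours, and any [m]
    of them form a blue star around [v]. *)
Lemma red_degree m (v : red) : ~~ mono_copy c false (star m) -> N <= degree v + m.
Proof.
apply: contraNT; rewrite -ltnNge => lt.
pose B := [set y : red | (y != v) && ~~ c [set (v : 'I_N); (y : 'I_N)]].
have [|S SB cS] := @exists_subset_card _ B m.
  have cN : N = #|v |: (B :|: [set y | adj v y])|.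
    rewrite -[LHS]card_ord -cardsT; apply: eq_card => y; rewrite !inE /= /red_adj.
    by rewrite [v == y]eq_sym; case: (y == v) (c _) => [] [].
  have := (leq_card_setU B [set y | adj v y]).1.
  have := (leq_card_setU [set v] (B :|: [set y | adj v y])).1.
  by rewrite cards1 -cN -/(degree v); move: lt; clear; lia.
pose g (i : 'I_m) : red := enum_val (cast_ord (esym cS) i).
have gB i : g i \in B by apply/(subsetP SB)/enum_valP.
have inj_g : injective g by move=> i j /enum_val_inj/cast_ord_inj.
apply/existsP; exists [ffun x : star m => if x is Some i then g i else v].
apply/andP; split.
  apply/injectiveP => -[i|] [j|]; rewrite !ffunE //.
  - by move/inj_g->.
  - by move=> gv; have := gB i; rewrite inE gv eqxx.
  - by move=> gv; have := gB j; rewrite inE -gv eqxx.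
apply/forallP => -[i|]; apply/forallP => -[j|]; apply/implyP => //= _; rewrite !ffunE.
  by have := gB i; rewrite setUC inE => /andP[_ /negPf->].
by have := gB j; rewrite inE => /andP[_ /negPf->].
Qed.

End Colouring.

Theorem theorem1p4 (m n : nat) (T : sgraph)
  (m_gt0 : 0 < m) (n_gt0 : 0 < n)
  (treeT : is_tree T) (cardT : #|T| = n)
  (degT : max_degree T + 3 <= n)
  (notTpq : forall p : nat, 0 < p -> 0 < n - 3 - p ->
    ~ isomorphic T (Tpq p (n - 3 - p)))
  (notcomb : ~ linear_combination [:: n - 1; n - 2] (m + n - 3)) :
  ramsey T (star m) <= m + n - 3.
Proof.
(* By minimality of the Ramsey number it suffices that [m + #|T| - 3] has the arrow property. *)
subst n; rewrite /ramsey; case: ex_minnP => k _; apply; apply/forallP => c.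
rewrite orbC; have [//|no_star] := boolP (mono_copy c false (star m)) => /=.
(* [red_degree] gives [m + #|T| - 3 <= degree v + m], from which [m] cancels. *)
have degR (v : red c) : #|T| <= degree v + 3.
  by have := red_degree v no_star; move: degT; clear; lia.
have [/existsP[r le_r]|/existsPn small] := boolP [exists r : red c, #|T| <= #|component r|].
  apply: (@mono_copy_component _ c T r); apply: embeds_connected => //.
  - move=> t; apply: leq_trans degT; rewrite leq_add2r.
    exact: (leq_bigmax t).
  - exact: component_connected.
  - by move=> v; rewrite component_degree.
case: notcomb; rewrite -[X in linear_combination _ X]card_ord.
apply: (component_card_lincomb (G := red c)) => // r.
by rewrite ltnNge.
Qed.
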